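(* Let $m,n\ge1$ be integers and let $G\subset K_{m,n}$ be a connected subgraph (on the full vertex set). If $\tau,\tau'$ are two different triangulations of $Q_G$, then the maps $\phi_\tau$ and $\phi_{\tau'}$ are different.
   Context: Let $[m]=\{1,\dots,m\}$ and let $[\bar n]=\{\bar 1,\dots,\bar n\}$ be a disjoint set of $n$ symbols. $K_{m,n}$ is the complete bipartite graph with vertex set $[m]\cup[\bar n]$ and edges $(i,\bar j)$; subgraphs are identified with edge sets. For a subgraph $H$, $N_{\bar j}(H)=\{i:(i,\bar j)\in H\}$. Let $e_1,\dots,e_m,e_{\bar1},\dots,e_{\bar n}$ be the standard basis of $\mathbb{R}^{m+n}$. For $I\subset[m]$, $\Delta_I\subset\mathbb{R}^m$ is the convex hull of $\{e_i:i\in I\}$. For sets $A,B$, $A+B$ is the Minkowski sum and $A-B=\{c:c+B\subset A\}$. Put $P_G=\sum_{\bar j\in[\bar n]}\Delta_{N_{\bar j}(G)}\subset\mathbb{R}^m$ and $P_G^-=P_G-\Delta_{[m]}$. $G^*\subset K_{n,m}$ is the graph with edge set $\{(j,\bar i):(i,\bar j)\in G\}$, and $P_{G^*}^-\subset\mathbb{R}^n$ is defined by the same recipe for $G^*$. For $F\subset G$ let $\Delta_F$ be the convex hull of $e_i-e_{\bar j}$, $(i,\bar j)\in F$; $Q_G:=\Delta_G$. A forest is a set of edges with no cycle. A triangulation $\tau$ of $Q_G$ is a simplicial complex each of whose simplices is $\Delta_F$ for a forest $F\subset G$, with $\Delta_F\cap\Delta_{F'}=\Delta_{F\cap F'}$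 for any two of its simplices, and with union $Q_G$. $\mathcal{T}(\tau)$ is the set of spanning trees $T$ of $G$ with $\Delta_T\in\tau$. For a spanning tree $T$ put $\mathrm{LD}^-(T)=(\deg_i(T)-1)_{i\in[m]}$ and $\mathrm{RD}^-(T)=(\deg_{\bar j}(T)-1)_{\bar j\in[\bar n]}$. It is known (Postnikov) that for every triangulation $\tau$ of $Q_G$, $\mathrm{LD}^-:\mathcal{T}(\tau)\to P_G^-\cap\mathbb{Z}^m$ and $\mathrm{RD}^-:\mathcal{T}(\tau)\to P_{G^*}^-\cap\mathbb{Z}^n$ are bijections. The bijection $\phi_\tau:P_G^-\cap\mathbb{Z}^m\to P_{G^*}^-\cap\mathbb{Z}^n$ is defined by $\phi_\tau(\mathrm{LD}^-(T))=\mathrm{RD}^-(T)$ for $T\in\mathcal{T}(\tau)$. *)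

(* Defs.v *)
From mathcomp Require Import all_boot all_order all_algebra.
From mathcomp Require Import boolp classical_sets reals convex.

Set Implicit Arguments.
Unset Strict Implicit.
Unset Printing Implicit Defensive.

Import GRing.Theory.
Local Open Scope classical_set_scope.
Local Open Scope ring_scope.

Definition convex_hull (R : realType) (V : lmodType R) (A : set V) : set V :=
  smallest (@convex_set R V) A.

Definition minkowski_add (V : zmodType) (A B : set V) : set V :=
  [set a + b | a in A & b in B].

Definition minkowski_sub (V : zmodType) (A B : set V) : set V :=
  [set c | [set c + b | b in B] `<=` A].

(* A subgraph of K_{m,n} on the full vertex set, given by its edges; (i, j)
   stands for the edge joining the left vertex i to the right vertex j. *)
Notation bigraph m n := {set 'I_m * 'I_n}.

Section Graphs.
Context {m n : nat}.
Implicit Types G F T : bigraph m n.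

Definition left_nbrs G (j : 'I_n) : {set 'I_m} := [set i | (i, j) \in G]%SET.
Definition right_nbrs G (i : 'I_m) : {set 'I_n} := [set j | (i, j) \in G]%SET.

Definition transpose_graph G : bigraph n m := [set (e.2, e.1) | e in G]%SET.

Definition adjacent G : rel ('I_m + 'I_n) := fun u v =>
  match u, v with
  | inl i, inr j => (i, j) \in G
  | inr j, inl i => (i, j) \in G
  | _, _ => false
  end.

Definition connected_graph G : Prop := forall u v, connect (adjacent G) u v.

(* A ucycle of length 2 runs back and forth along one edge and is not a cycle of
   the graph. *)
Definition forest F : Prop :=
  forall c : seq ('I_m + 'I_n), ucycle (adjacent F) c -> (size c <= 2)%N.

Definition spanning_tree G T : Prop :=
  [/\ T \subset G, forest T & connected_graph T].

Definition LDm T : 'rV[int]_m := \row_i (#|right_nbrs T i|%:Z - 1).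
Definition RDm T : 'rV[int]_n := \row_j (#|left_nbrs T j|%:Z - 1).

End Graphs.

Section Polytopes.
Variable R : realType.

Definition simplex (m : nat) (I : {set 'I_m}) : set 'rV[R]_m :=
  convex_hull [set delta_mx 0 i | i in [set` I]].

Definition PG (m n : nat) (G : bigraph m n) : set 'rV[R]_m :=
  \big[@minkowski_add 'rV[R]_m/[set 0]]_(j < n) simplex (left_nbrs G j).

Definition trimmedPG (m n : nat) (G : bigraph m n) : set 'rV[R]_m :=
  minkowski_sub (PG G) (simplex [set: 'I_m]%SET).

Definition lattice_points (m : nat) (P : set 'rV[R]_m) : set 'rV[int]_m :=
  [set a | P (map_mx intr a)].

Context {m n : nat}.
Implicit Types (G F T : bigraph m n) (tau : set (set 'rV[R]_(m + n))).

Definition root_vector (e : 'I_m * 'I_n) : 'rV[R]_(m + n) :=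
  delta_mx 0 (lshift n e.1) - delta_mx 0 (rshift m e.2).

(* For F = G this is the root polytope Q_G. *)
Definition root_polytope F : set 'rV[R]_(m + n) :=
  convex_hull [set root_vector e | e in [set` F]].

(* The vertices root_vector e, e \in F, of the polytope of a forest F are affinely
   independent, so that its faces are the root_polytope F' for F' \subset F. The
   empty face is included, so it belongs to every triangulation. *)
Definition triangulation G tau : Prop :=
  [/\ forall s, tau s ->
        exists F, [/\ F \subset G, forest F & s = root_polytope F],
      forall F F', forest F -> tau (root_polytope F) -> F' \subset F ->
        tau (root_polytope F'),
      forall F F', forest F -> forest F' ->
        tau (root_polytope F) -> tau (root_polytope F') ->
        root_polytope F `&` root_polytope F' = root_polytope (F :&: F')
    & \bigcup_(s in tau) s = root_polytope G].

Definition triangulation_trees G tau : set (bigraph m n) :=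
  [set T | spanning_tree G T /\ tau (root_polytope T)].

(* For a triangulation tau of Q_G, LDm and RDm are bijections from the trees of
   tau to the lattice points of trimmedPG G and of trimmedPG (transpose_graph G);
   hence for a in the former set there is exactly one such b. Elsewhere the
   value is the irrelevant default 0. *)
Definition phi G tau (a : 'rV[int]_m) : 'rV[int]_n :=
  xget 0 [set b | lattice_points (trimmedPG (transpose_graph G)) b /\
                  exists2 T, triangulation_trees G tau T &
                             LDm T = a /\ RDm T = b].

End Polytopes.

Arguments PG R {m n} G.
Arguments trimmedPG R {m n} G.
Arguments root_polytope R {m n} F.

(* Main.v *)
Require Import Defs.
From mathcomp Require Import all_boot all_order all_algebra.
From mathcomp Require Import boolp reals.
From mathcomp Require Import zify ring lra.

(** Call two trees of two triangulations matched when they have the same left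
    and right degrees; equality of the two maps [phi] says that every tree [T]
    of [tau] is matched with a tree [T'] of [tau'], and the point is that
    matched trees are equal.

    A triangulation enters only through the family of forests of its simplices.
    Two facts about this family are used: every nonnegative edge weight on [G]
    has the same vertex sums (fluxes) as a nonnegative weight on some member, and
    two nonnegative weights on members with equal fluxes are equal
    ([forest_complex]).  In particular two edge sets contained in members and
    having the same degrees are equal ([complex_inj_set]).

    Orienting a tree [T] towards a left vertex [k] and keeping the edge from each
    right vertex to its parent gives a subset of [T] with right degrees 1 and
    left degrees [LDm T + e_k] ([tree_rooted]); the tree is the union of these
    subsets over [k].  Hence if the trees [T], [U] of [tau] satisfy
    [LDm U = LDm T + e_k - e_i], the set of [T] at [k] is the set of [U] at [i],
    and lies in [U] ([shared_root]).  Conversely, the point whose fluxes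
    are the average of prescribed left degrees [a + e_k] must lie in the interior
    of a simplex of a tree with [LDm] equal to [a] ([tree_of_root_family]).

    The key step is that matched trees have the same leaf edges
    ([leaf_matched]).  Let the right vertex [j] be a leaf of [T] with edge
    [e = (k, j)] and a leaf of [T'] with edge [e' = (k', j)], [k != k'].
    Reattaching [j] to [k] in [T'] gives a spanning tree of [G], so [tau] has a
    tree [U] with [LDm U = LDm T + e_k - e_k'].  Comparing root sets shows that
    [e] is still the only edge of [U] at [j] ([leaf_shared]), and that [e'] is
    still the only edge at [j] of the tree [U'] matched with [U]. The situation
    has been reproduced with a larger degree at [k], which cannot go on forever.

    The trees are then compared by induction ([rigid_step]): the leaf [j] is
    deleted from [G], where the two families restrict to families of the same
    kind.  A tree of a restricted family extends by a leaf to a tree of the whole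
    family, because every simplex lies in the simplex of a tree
    ([tree_supset]), so the leaf edges being equal the restricted families are
    matched again.  Left leaves are treated by exchanging the two sides.
    Finally all simplices are faces of simplices of trees, so the triangulations
    coincide. *)

Set Implicit Arguments.
Unset Strict Implicit.
Unset Printing Implicit Defensive.

Import Order.TTheory GRing.Theory Num.Theory.

Local Open Scope ring_scope.

(** * Degrees and fluxes *)

(** Edges form an arbitrary finite type [X] and the endpoints are maps [l] and
    [r] out of it, so that exchanging the two sides of a bipartite graph amounts
    to exchanging [l] and [r]; [f] is either of them. *)
Definition deg (X V : finType) (f : X -> V) (E : {set X}) (v : V) : nat :=
  (\sum_(x in E) (f x == v))%N.

Definition flux (R : realType) (X V : finType) (f : X -> V) (w : X -> R)
  (v : V) : R := \sum_(x | f x == v) w x.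

Definition edge_ind (R : realType) (X : finType) (E : {set X}) : X -> R :=
  fun x => (x \in E)%:R.
Arguments edge_ind R {X} E x.

Section Degrees.
Context {X V : finType} (f : X -> V).
Implicit Types (E : {set X}) (v : V) (x y : X).

Lemma degU1 E x v : x \notin E -> deg f (x |: E) v = ((f x == v) + deg f E v)%N.
Proof. by move=> xE; rewrite /deg big_setU1. Qed.

Lemma degD1 E x v : x \in E -> deg f E v = ((f x == v) + deg f (E :\ x) v)%N.
Proof. by move=> xE; rewrite /deg (big_setD1 x). Qed.

Lemma deg_card E v : deg f E v = #|[set x in E | f x == v]|.
Proof.
rewrite /deg -sum1_card [RHS](eq_bigl [pred x | (x \in E) && (f x == v)]).
  by rewrite big_mkcondr.
by move=> x; rewrite inE.
Qed.

Lemma deg_sub E E' v : E \subset E' -> (deg f E v <= deg f E' v)%N.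
Proof.
move=> EE'; rewrite !deg_card; apply: subset_leq_card; apply/subsetP => x.
by rewrite !inE => /andP[/(subsetP EE') -> ->].
Qed.

Lemma deg_gt0 E x : x \in E -> (0 < deg f E (f x))%N.
Proof. by move=> xE; rewrite (degD1 _ xE) eqxx. Qed.

Lemma deg_gt0P E v : (0 < deg f E v)%N -> exists2 x, x \in E & f x = v.
Proof.
rewrite deg_card => /card_gt0P[x]; rewrite inE => /andP[xE /eqP]; by exists x.
Qed.

Lemma deg_eq1 E v : deg f E v = 1%N ->
  exists x, [/\ x \in E, f x = v & forall y, y \in E -> f y = v -> y = x].
Proof.
rewrite deg_card => /eqP/cards1P[x Ex]; exists x.
have: x \in [set x in E | f x == v] by rewrite Ex set11.
rewrite inE => /andP[xE /eqP fx]; split=> // y yE fy.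
by apply/set1P; rewrite -Ex inE yE fy /=.
Qed.

Lemma deg_eq1_inj E v x y : deg f E v = 1%N -> x \in E -> y \in E ->
  f x = v -> f y = v -> x = y.
Proof. by move=> /deg_eq1[z [_ _ Ez]] xE yE fx fy; rewrite (Ez x) // (Ez y). Qed.

Lemma deg_full E E' x : E \subset E' -> deg f E (f x) = deg f E' (f x) ->
  x \in E' -> x \in E.
Proof.
move=> EE' dE xE'; have /eqP := dE; rewrite !deg_card => dE'.
have sub : [set y in E | f y == f x] \subset [set y in E' | f y == f x].
  by apply/subsetP => y; rewrite !inE => /andP[/(subsetP EE') -> ->].
have := subset_cardP (eqP dE') sub x.
by rewrite !inE xE' eqxx andbT.
Qed.

Lemma sum_deg E : (\sum_v deg f E v = #|E|)%N.
Proof.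
rewrite /deg exchange_big /= -sum1_card; apply: eq_bigr => x _.
by rewrite (bigD1 (f x)) //= eqxx big1 // => v /negPf; rewrite eq_sym => ->.
Qed.

Lemma eq_deg_card E E' : deg f E =1 deg f E' -> #|E| = #|E'|.
Proof. by move=> dE; rewrite -!sum_deg; apply: eq_bigr. Qed.

Context {R : realType}.
Implicit Types w : X -> R.

Lemma flux_ind E v : flux f (edge_ind R E) v = (deg f E v)%:R.
Proof.
rewrite /flux /deg natr_sum big_mkcond [RHS]big_mkcond; apply: eq_bigr => x _.
by rewrite /edge_ind; case: (x \in E); case: (f x == v).
Qed.

Lemma fluxD w w' v : flux f (fun x => w x + w' x) v = flux f w v + flux f w' v.
Proof. by rewrite /flux big_split. Qed.

Lemma fluxB w w' v : flux f (fun x => w x - w' x) v = flux f w v - flux f w' v.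
Proof. by rewrite /flux sumrB. Qed.

Lemma fluxZ a w v : flux f (fun x => a * w x) v = a * flux f w v.
Proof. by rewrite /flux mulr_sumr. Qed.

Lemma flux_sum (Y : finType) (P : pred Y) (w : Y -> X -> R) v :
  flux f (fun x => \sum_(y | P y) w y x) v = \sum_(y | P y) flux f (w y) v.
Proof. by rewrite /flux exchange_big. Qed.

Lemma eq_flux w w' v : w =1 w' -> flux f w v = flux f w' v.
Proof. by move=> ww'; apply: eq_bigr. Qed.

Lemma sum_flux w : \sum_v flux f w v = \sum_x w x.
Proof.
rewrite /flux (exchange_big_dep predT) //=; apply: eq_bigr => x _.
by rewrite (eq_bigl (pred1 (f x))) ?big_pred1_eq // => v; rewrite /= eq_sym.
Qed.

Lemma flux_one x v : flux f (fun y => (y == x)%:R) v = (f x == v)%:R :> R.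
Proof.
rewrite /flux; case: eqP => [fx|fx]; last first.
  by rewrite big1 // => y /eqP fy; case: eqP => // yx; case: fx; rewrite -yx.
rewrite (bigD1 x) ?fx //= eqxx big1 ?addr0 // => y /andP[_ /negPf -> //].
Qed.

Lemma le_flux w x : (forall y, 0 <= w y) -> w x <= flux f w (f x).
Proof.
by move=> w0; rewrite /flux (bigD1 x) //= lerDl sumr_ge0.
Qed.

Lemma flux_single w E v x : (forall y, y \notin E -> w y = 0) ->
  f x = v -> (forall y, y \in E -> f y = v -> y = x) -> flux f w v = w x.
Proof.
move=> w0 fx Ex; rewrite /flux (bigD1 x) ?fx //= big1 ?addr0 //.
move=> y /andP[/eqP fy yx]; apply: w0; apply: contra yx => yE.
by apply/eqP; apply: Ex.
Qed.

End Degrees.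

(** * Leafy edge sets and trees *)

Section Forests.
Context {X A B : finType}.
Variables (l : X -> A) (r : X -> B).
Implicit Types (E F T : {set X}) (I : {set A}) (J : {set B}).

(** The absence of cycles in the form in which it is used: edges can be peeled
    off one at a time at vertices of degree 1. *)
Definition leafy F : Prop := forall E, E \subset F -> E != set0 ->
  (exists i, deg l E i = 1%N) \/ (exists j, deg r E j = 1%N).

Definition inside I J : {set X} := [set x | (l x \in I) && (r x \in J)].

(** The edge count replaces connectedness; unlike the latter it is visibly
    stable under removing and adding leaves. *)
Definition tree I J T : Prop :=
  [/\ leafy T, T \subset inside I J & #|T|.+1 = (#|I| + #|J|)%N].

Lemma leafy_sub E F : E \subset F -> leafy F -> leafy E.
Proof. by move=> EF lF E' E'E; apply: lF; apply: subset_trans EF. Qed.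

Context {R : realType}.

(** The weight of a leaf edge is the flux at its leaf; peeling off leaves
    determines all weights from the fluxes by subtractions.  With [P] being [= 0]
    this is the linear independence of the vectors of a forest, and with [P]
    being integrality it is their unimodularity. *)
Lemma leafy_flux (P : R -> Prop) F (w : X -> R) :
  P 0 -> (forall a b, P a -> P b -> P (a - b)) ->
  leafy F -> (forall x, x \notin F -> w x = 0) ->
  (forall i, P (flux l w i)) -> (forall j, P (flux r w j)) ->
  forall x, P (w x).
Proof.
move=> P0 PB; elim: {F}#|F| {-2}F w (erefl #|F|) => [|n IH] F w cF lF wF wl wr x.
  by rewrite wF // (cards0_eq cF) inE.
suff [y yF wy] : exists2 y, y \in F & P (w y).
  have [-> // | xy] := eqVneq x y.
  pose w' z := w z - w y * (z == y)%:R.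
  have -> : w x = w' x by rewrite /w' (negPf xy) mulr0 subr0.
  have flux' (V : finType) (f : X -> V) v :
      (forall u, P (flux f w u)) -> P (flux f w' v).
    move=> fP; rewrite fluxB fluxZ flux_one; case: eqP => _.
      by rewrite mulr1; apply: PB.
    by rewrite mulr0 subr0.
  apply: (IH (F :\ y)) => [||z|i|j]; [| | |exact: flux'|exact: flux'].
  - by move: cF; rewrite (cardsD1 y) yF => -[].
  - by apply: leafy_sub lF; apply: subD1set.
  rewrite !inE negb_and negbK /w' => /orP[/eqP -> | zF].
    by rewrite eqxx mulr1 subrr.
  have /negPf -> : z != y by apply: contraNneq zF => ->.
  by rewrite mulr0 subr0 wF.
have := lF F (subxx _); rewrite -card_gt0 cF => /(_ isT) [[i]|[j]].
  move=> /deg_eq1[y [yF ly Ey]]; exists y => //.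
  by rewrite -(flux_single wF ly Ey).
move=> /deg_eq1[y [yF ly Ey]]; exists y => //.
by rewrite -(flux_single wF ly Ey).
Qed.

Lemma leafy_flux_eq F (w w' : X -> R) : leafy F ->
  (forall x, x \notin F -> w x = 0) -> (forall x, x \notin F -> w' x = 0) ->
  flux l w =1 flux l w' -> flux r w =1 flux r w' -> w =1 w'.
Proof.
move=> lF wF w'F ll rr x; apply/eqP; rewrite -subr_eq0; apply/eqP.
apply: (@leafy_flux (fun a => a = 0) F (fun x => w x - w' x)) => //.
- by move=> a b -> ->; rewrite subrr.
- by move=> y yF; rewrite wF // w'F // subrr.
- by move=> i; rewrite fluxB ll subrr.
- by move=> i; rewrite fluxB rr subrr.
Qed.

End Forests.

Section Swap.
Context {X A B : finType} (l : X -> A) (r : X -> B).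

Lemma leafyC F : leafy l r F -> leafy r l F.
Proof. by move=> lF E EF E0; case: (lF E EF E0) => H; [right | left]. Qed.

Lemma treeC I J T : tree l r I J T -> tree r l J I T.
Proof.
case=> lT TIJ cT; split; [exact: leafyC | | by rewrite addnC].
by apply: subset_trans TIJ _; apply/subsetP => x; rewrite !inE andbC.
Qed.

End Swap.

Section Trees.
Context {X A B : finType}.
Variables (l : X -> A) (r : X -> B).
Implicit Types (E F T : {set X}) (I : {set A}) (J : {set B}) (v : A + B).

Lemma tree_mem I J T x : tree l r I J T -> x \in T -> (l x \in I) * (r x \in J).
Proof.
by case=> _ TIJ _ /(subsetP TIJ); rewrite inE => /andP[-> ->].
Qed.

Lemma tree_leaf I J T : tree l r I J T -> T != set0 ->
  exists2 x, x \in T & deg l T (l x) = 1%N \/ deg r T (r x) = 1%N.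
Proof.
case=> lT _ _ T0; have [[i d]|[j d]] := lT T (subxx _) T0.
  by have [x [xT lx _]] := deg_eq1 d; exists x => //; left; rewrite lx.
by have [x [xT lx _]] := deg_eq1 d; exists x => //; right; rewrite lx.
Qed.

Lemma tree_cutr I J T x : tree l r I J T -> x \in T -> deg r T (r x) = 1%N ->
  tree l r I (J :\ r x) (T :\ x).
Proof.
move=> tT xT dx; have [lT TIJ cT] := tT; split.
- by apply: leafy_sub lT; apply: subD1set.
- apply/subsetP => y; rewrite !inE => /andP[yx yT].
  rewrite !(tree_mem tT yT) andbT /=; apply: contraNneq yx => ryx.
  by rewrite (deg_eq1_inj dx yT xT).
- move: cT; rewrite (cardsD1 x T) xT (cardsD1 (r x) J) (tree_mem tT xT).2; lia.
Qed.

Lemma tree_addr I J T x : tree l r I J T -> l x \in I -> r x \notin J ->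
  tree l r I (r x |: J) (x |: T).
Proof.
move=> tT lx rx; have [lT TIJ cT] := tT.
have xT : x \notin T by apply: contraNN rx => /(tree_mem tT) [].
split.
- move=> E ET E0; case: (boolP (x \in E)) => xE; last first.
    by apply: lT E0; apply/subsetP => y yE; have := subsetP ET y yE;
       rewrite !inE; case: eqP => // yx; rewrite -yx yE in xE.
  right; exists (r x); rewrite (degD1 _ _ xE) eqxx /deg big1 // => y.
  rewrite !inE => /andP[yx /(subsetP ET)]; rewrite !inE (negPf yx) /= => yT.
  by case: eqP => // ryx; rewrite -ryx (tree_mem tT yT) in rx.
- apply/subsetP => y; rewrite !inE => /orP[/eqP -> | yT].
    by rewrite lx eqxx.
  by rewrite !(tree_mem tT yT) orbT.
- by rewrite !cardsU1 xT rx; lia.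
Qed.

Definition vertex I J v := match v with inl i => i \in I | inr j => j \in J end.

(** Orient the tree [T] towards its vertex [v]: [E] consists of the edges joining
    a right vertex to its parent.  A right vertex other than [v] has one parent,
    and a left vertex is the parent along all its edges but one, or along all of
    them if it is [v].  These degrees pin [E] down, so they serve as the
    definition. *)
Definition rooted I J T v E : Prop :=
  [/\ E \subset T,
      forall i, (deg l E i + (i \in I) = deg l T i + (v == inl i))%N &
      forall j, (deg r E j + (v == inr j) = (j \in J))%N].

Lemma mem_split (V : finType) (S : {set V}) s u : s \in S ->
  (u \in S : nat) = ((s == u) + (u \in S :\ s))%N.
Proof. by move=> sS; rewrite !inE (eq_sym u); case: eqP => //= <-; rewrite sS. Qed.

Lemma deg_set0 (V : finType) (f : X -> V) u : deg f set0 u = 0%N.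
Proof. by rewrite /deg big_set0. Qed.

End Trees.

Section Rooted.
Context {X A B : finType}.
Variables (l : X -> A) (r : X -> B).
Implicit Types (E F T : {set X}) (I : {set A}) (J : {set B}) (v : A + B).

Lemma tree_cutl I J T x : tree l r I J T -> x \in T -> deg l T (l x) = 1%N ->
  tree l r (I :\ l x) J (T :\ x).
Proof. by move=> /treeC tT xT dx; apply/treeC/tree_cutr. Qed.

Lemma tree_addl I J T x : tree l r I J T -> r x \in J -> l x \notin I ->
  tree l r (l x |: I) J (x |: T).
Proof. by move=> /treeC tT xT dx; apply/treeC/tree_addr. Qed.

(** Induction on leaves.  When the leaf is the root itself, the smaller tree is
    rooted at the other end of the leaf edge. *)
Lemma tree_rooted I J T v : tree l r I J T -> vertex I J v ->
  exists E, rooted l r I J T v E.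
Proof.
elim: {T}#|T| {-2}T I J v (erefl #|T|) => [|n IH] T I J v cT tT vIJ.
  move: tT; rewrite (cards0_eq cT) => -[_ _]; rewrite cards0 => cIJ.
  (* A tree without edges has [v] as its only vertex. *)
  have [I1 J1] : (forall i, (i \in I) = (v == inl i)) /\
                 (forall j, (j \in J) = (v == inr j)).
    case: v vIJ => [k kI | k kJ].
    - rewrite /= in kI; move: cIJ.
      rewrite (cardsD1 k I) kI add1n addSn => -[/esym/eqP].
      rewrite addn_eq0 !cards_eq0 => /andP[/eqP Ik /eqP ->]; split=> u.
        have := mem_split u kI.
        rewrite Ik inE addn0 (_ : (inl k == inl u) = (k == u)) //.
        by case: (u \in I); case: (k == u).
      by rewrite inE.
    - rewrite /= in kJ; move: cIJ.
      rewrite (cardsD1 k J) kJ add1n addnS => -[/esym/eqP].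
      rewrite addn_eq0 !cards_eq0 => /andP[/eqP -> /eqP Jk]; split=> u.
        by rewrite inE.
      have := mem_split u kJ.
      rewrite Jk inE addn0 (_ : (inr k == inr u) = (k == u)) //.
      by case: (u \in J); case: (k == u).
  by exists set0; split=> [|i|j]; rewrite ?sub0set // !deg_set0 ?I1 ?J1.
have [|x xT dx] := tree_leaf tT; first by rewrite -card_gt0 cT.
have [lx rx] := tree_mem tT xT.
have cT0 : #|T :\ x| = n by move: cT; rewrite (cardsD1 x) xT => -[].
case: dx => dx.
- have t0 := tree_cutl tT xT dx.
  have [E0 | vl] := eqVneq v (inl (l x)).
    have [|E [ET El Er]] := IH _ _ _ (inr (r x)) cT0 t0; first exact: rx.
    have xE : x \notin E by apply/negP => /(subsetP ET); rewrite !inE eqxx.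
    exists (x |: E); split.
    - by rewrite subUset sub1set xT (subset_trans ET) ?subD1set.
    - move=> i; rewrite degU1 // (degD1 _ _ xT) (mem_split _ lx) E0.
      by move: (El i); rewrite (_ : (inl (l x) == inl i) = (l x == i)) //=; lia.
    - move=> j; rewrite degU1 // -(Er j) E0.
      by rewrite (_ : (inr (r x) == inr j) = (r x == j)) //=; lia.
  have [|E [ET El Er]] := IH _ _ _ v cT0 t0.
    case: v vIJ vl => //= i iI; rewrite !inE iI andbT; by apply: contraNneq => ->.
  exists E; split=> //.
  - by rewrite (subset_trans ET) ?subD1set.
  - by move=> i; rewrite (degD1 _ _ xT) (mem_split _ lx); move: (El i); lia.
- have t0 := tree_cutr tT xT dx.
  have [E0 | vr] := eqVneq v (inr (r x)).
    have [|E [ET El Er]] := IH _ _ _ (inl (l x)) cT0 t0; first exact: lx.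
    exists E; split.
    - by rewrite (subset_trans ET) ?subD1set.
    - move=> i; rewrite (degD1 _ _ xT) E0.
      by move: (El i); rewrite (_ : (inl (l x) == inl i) = (l x == i)) //=; lia.
    - move=> j; rewrite (mem_split _ rx) -(Er j) E0.
      by rewrite (_ : (inr (r x) == inr j) = (r x == j)) //=; lia.
  have [|E [ET El Er]] := IH _ _ _ v cT0 t0.
    case: v vIJ vr => //= j jJ; rewrite !inE jJ andbT; by apply: contraNneq => ->.
  have xE : x \notin E by apply/negP => /(subsetP ET); rewrite !inE eqxx.
  exists (x |: E); split.
  - by rewrite subUset sub1set xT (subset_trans ET) ?subD1set.
  - by move=> i; rewrite degU1 // (degD1 _ _ xT); move: (El i); lia.
  - by move=> j; rewrite degU1 // (mem_split _ rx); move: (Er j); lia.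
Qed.

Lemma rootedl I J T k E : rooted l r I J T (inl k) E ->
  [/\ E \subset T, forall i, (deg l E i + (i \in I) = deg l T i + (k == i))%N
    & forall j, deg r E j = (j \in J)].
Proof. by case=> ? ? Er; split=> // j; rewrite -Er addn0. Qed.

(** The left endpoint of [x] has its full degree in the set rooted there; hence a
    tree is the union of the sets rooted at its left vertices. *)
Lemma rooted_full I J T x E : tree l r I J T -> x \in T ->
  rooted l r I J T (inl (l x)) E -> x \in E.
Proof.
move=> tT xT /rootedl[ET El _]; apply: (deg_full (f := l) ET) => //.
have := El (l x); rewrite eqxx (tree_mem tT xT) => /eqP.
by rewrite eqn_add2r => /eqP.
Qed.

Lemma tree_roots I J T : tree l r I J T ->
  exists E : A + B -> {set X}, forall v, vertex I J v -> rooted l r I J T v (E v).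
Proof.
move=> tT; have /choice[E EP] : forall v, exists E,
    vertex I J v -> rooted l r I J T v E.
  move=> v; case: (boolP (vertex I J v)) => [/(tree_rooted tT)[E ER] | nv].
    by exists E.
  by exists set0.
by exists E.
Qed.

(** Grow a tree inside [F] by adding leaves until no edge of [F] leaves it: its
    vertices then form the connected component of [i0] in [F]. *)
Lemma max_subtree F i0 : exists I J T,
  [/\ tree l r I J T, T \subset F, i0 \in I &
      forall x, x \in F -> (l x \in I) = (r x \in J)].
Proof.
suff grow n I J T : tree l r I J T -> T \subset F -> i0 \in I ->
    (#|F| - #|T| = n)%N -> exists I J T,
  [/\ tree l r I J T, T \subset F, i0 \in I &
      forall x, x \in F -> (l x \in I) = (r x \in J)].
  apply: (grow _ [set i0] set0 set0); rewrite ?sub0set ?set11 //; split.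
  - by move=> E; rewrite subset0 => /eqP ->; rewrite eqxx.
  - exact: sub0set.
  - by rewrite !cards0 cards1.
elim/ltn_ind: n I J T => n IH I J T tT TF i0I nE.
have [clo | ] := boolP [forall x in F, (l x \in I) == (r x \in J)].
  exists I, J, T; split=> // x xF.
  by move/forall_inP: clo => /(_ x xF) /eqP.
rewrite negb_forall_in => /exists_inP[x xF neq].
have xT : x \notin T.
  by apply: contraNN neq => /(tree_mem tT) [-> ->].
have xTF : x |: T \subset F by rewrite subUset sub1set xF.
have lt : (#|F| - #|x |: T| < n)%N.
  by have := subset_leq_card xTF; rewrite cardsU1 xT -nE; lia.
case: (boolP (l x \in I)) neq => lx; case: (boolP (r x \in J)) => // rx _.
  exact: (IH _ lt _ _ _ (tree_addr tT lx rx)).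
by apply: (IH _ lt _ _ _ (tree_addl tT rx lx)) => //; rewrite inE i0I orbT.
Qed.

Context {R : realType}.

(** No edge of [F] leaves the union of [I] and [J], so each side counts all the
    weight inside. *)
Lemma flux_cut F I J (w : X -> R) : (forall x, x \notin F -> w x = 0) ->
  (forall x, x \in F -> (l x \in I) = (r x \in J)) ->
  \sum_(i in I) flux l w i = \sum_(j in J) flux r w j.
Proof.
move=> wF clo.
have E (V : finType) (f : X -> V) (S : {set V}) :
    \sum_(i in S) flux f w i = \sum_(x | f x \in S) w x.
  rewrite /flux (exchange_big_dep (fun x => f x \in S)) /=; last first.
    by move=> i x ? /eqP->.
  apply: eq_bigr => x fx; rewrite (eq_bigl (pred1 (f x))) ?big_pred1_eq // => i /=.
  by rewrite eq_sym; case: eqP => [->|]; rewrite ?fx ?andbF.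
rewrite !E big_mkcond [RHS]big_mkcond; apply: eq_bigr => x _.
by case: (boolP (x \in F)) => [/clo -> // | /wF ->]; rewrite !if_same.
Qed.

(** The vector of an edge is an integral combination of the edges of a tree: the
    sets rooted at its two endpoints differ by the path joining them. *)
Lemma tree_coord I J T x : tree l r I J T -> x \in inside l r I J ->
  exists g : X -> R, [/\ forall y, g y \is a Num.int, forall y, g y <= 1,
    forall y, y \notin T -> g y = 0,
    forall i, flux l g i = (l x == i)%:R & forall j, flux r g j = (r x == j)%:R].
Proof.
move=> tT; rewrite inE => /andP[lx rx].
have [E [ET El Er]] := tree_rooted (v := inl (l x)) tT lx.
have [E' [ET' El' Er']] := tree_rooted (v := inr (r x)) tT rx.
exists (fun y => edge_ind R E y - edge_ind R E' y); split=> [y|y|y yT|i|j].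
- by rewrite rpredB ?natr_int.
- by rewrite /edge_ind; case: (y \in E); case: (y \in E'); rewrite /=; lra.
- rewrite /edge_ind; case: (boolP (y \in E)) => [/(subsetP ET)|].
     by rewrite (negPf yT).
  by case: (boolP (y \in E')) => [/(subsetP ET')|]; rewrite ?(negPf yT) // subrr.
- have e : deg l E i = (deg l E' i + (l x == i))%N.
    move: (El i) (El' i); rewrite (_ : (inl (l x) == inl i) = (l x == i)) //=; lia.
  by rewrite fluxB !flux_ind e natrD addrAC subrr add0r.
- have e : deg r E j = (deg r E' j + (r x == j))%N.
    move: (Er j) (Er' j); rewrite (_ : (inr (r x) == inr j) = (r x == j)) //=; lia.
  by rewrite fluxB !flux_ind e natrD addrAC subrr add0r.
Qed.

(** By [tree_coord] a further edge of [F] would depend linearly on [T]. *)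
Lemma leafy_tree_eq I J T F : tree l r I J T -> T \subset F -> leafy l r F ->
  F \subset inside l r I J -> F = T.
Proof.
move=> tT TF lF FIJ; apply/eqP; rewrite eqEsubset TF andbT; apply/subsetP => x xF.
have [g [_ _ gT gl gr]] := tree_coord tT (subsetP FIJ x xF).
have := leafy_flux_eq (w := g) (w' := fun y => (y == x)%:R) lF.
case/(_ _ _ _ _ x)/Wrap => [y yF | y yF | i | j | [gx]].
- by apply: gT; apply: contraNN yF => /(subsetP TF).
- by case: eqP yF => // ->; rewrite xF.
- by rewrite gl flux_one.
- by rewrite gr flux_one.
- by apply/negPn/negP => /gT; rewrite gx eqxx; move/eqP; rewrite oner_eq0.
Qed.

End Rooted.

(** * Complexes of forests *)

(** The forests spanning the simplices of a triangulation of the root polytope of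
    [G].  A point of the cone over that polytope is recorded by its coordinates,
    which are the fluxes of a weight: [complex_inj] says that cones over simplices
    meet along common faces, [complex_cover] that they cover.  The geometry
    enters through these properties only, and they survive the deletion of a
    vertex of [G]. *)
Record forest_complex (R : realType) (X A B : finType) (l : X -> A)
    (r : X -> B) (G : {set X}) (K : {set X} -> Prop) : Prop := ForestComplex {
  complex_sub : forall F, K F -> F \subset G;
  complex_leafy : forall F, K F -> leafy l r F;
  complex_face : forall F F' : {set X}, K F -> F' \subset F -> K F';
  complex_inj : forall (F F' : {set X}) (w w' : X -> R), K F -> K F' ->
    (forall x, 0 <= w x) -> (forall x, 0 <= w' x) ->
    (forall x, x \notin F -> w x = 0) -> (forall x, x \notin F' -> w' x = 0) ->
    flux l w =1 flux l w' -> flux r w =1 flux r w' -> w =1 w';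
  complex_cover : forall w : X -> R,
    (forall x, 0 <= w x) -> (forall x, x \notin G -> w x = 0) ->
    exists F w', [/\ K F, forall x, 0 <= w' x, forall x, x \notin F -> w' x = 0,
      flux l w' =1 flux l w & flux r w' =1 flux r w]
}.

Section Complexes.
Context {R : realType} {X A B : finType} {l : X -> A} {r : X -> B}.
Implicit Types (E F T : {set X}) (I : {set A}) (J : {set B}).

Lemma complexC G K : forest_complex R l r G K -> forest_complex R r l G K.
Proof.
case=> Ks Kl Kf Ki Kc; split=> //.
- by move=> F /Kl /leafyC.
- move=> F F' w w' KF KF' w0 w'0 wF w'F' el er; exact: (Ki F F').
- move=> w w0 /(Kc w w0)[F [w' [? ? ? ? ?]]]; by exists F, w'.
Qed.

(** Equal degrees mean equal sums of edge vectors, and that sum is an interior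
    point of the cones over both faces. *)
Lemma complex_inj_set G K F F' E E' : forest_complex R l r G K ->
  K F -> K F' -> E \subset F -> E' \subset F' ->
  deg l E =1 deg l E' -> deg r E =1 deg r E' -> E = E'.
Proof.
move=> hK KF KF' EF EF' el er; apply/setP => x.
have ind0 (S S' : {set X}) y : S \subset S' -> y \notin S' -> edge_ind R S y = 0.
  by move=> SS' yS'; rewrite /edge_ind (negPf (contraNN (subsetP SS' y) yS')).
have /(_ x) /eqP := complex_inj (w := edge_ind R E) (w' := edge_ind R E')
  hK KF KF' (fun _ => ler0n _ _) (fun _ => ler0n _ _)
  (fun y => @ind0 _ _ y EF) (fun y => @ind0 _ _ y EF')
  (fun i => etrans (flux_ind l E i) (etrans (congr1 _ (el i)) (esym (flux_ind l E' i))))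
  (fun i => etrans (flux_ind r E i) (etrans (congr1 _ (er i)) (esym (flux_ind r E' i)))).
by rewrite eqr_nat; case: (x \in E); case: (x \in E').
Qed.

Lemma tree_degl_gt0 I J T i0 i : tree l r I J T -> i0 \in I -> i \in I ->
  i != i0 -> (0 < deg l T i)%N.
Proof.
move=> tT i0I iI ne; have [E /rootedl[_ El _]] := tree_rooted (v := inl i0) tT i0I.
by have := El i; rewrite iI eq_sym (negPf ne); lia.
Qed.

Lemma tree_degr_gt0 I J T i0 j : tree l r I J T -> i0 \in I -> j \in J ->
  (0 < deg r T j)%N.
Proof.
move=> tT i0I jJ; have [E /rootedl[ET _ Er]] := tree_rooted (v := inl i0) tT i0I.
by apply: leq_trans (deg_sub r j ET); rewrite Er jJ.
Qed.

Lemma int_lt1 (x : R) : x \is a Num.int -> x < 1 -> x <= 0.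
Proof. by move=> /intrP[k ->]; rewrite ltrz1 lerz0; lia. Qed.

(** The fluxes in [1/|I| + Z] on the left and in [Z] on the right put the point in
    general position: over a component of the support the two sides have equal
    total flux, so the number of left vertices in the component is divisible by
    [|I|], and the component is everything. *)
Lemma carrier_tree G K I J i0 (w : X -> R) : forest_complex R l r G K ->
  i0 \in I -> (forall x, 0 <= w x) -> (forall x, x \notin G -> w x = 0) ->
  (forall i, i \in I -> flux l w i - #|I|%:R^-1 \is a Num.int) ->
  (forall i, i \notin I -> flux l w i = 0) ->
  (forall j, j \in J -> flux r w j \is a Num.int /\ 0 < flux r w j) ->
  (forall j, j \notin J -> flux r w j = 0) ->
  exists T c, [/\ K T, tree l r I J T,
    (forall x, 0 <= c x) /\ (forall x, x \notin T -> c x = 0),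
    flux l c =1 flux l w & flux r c =1 flux r w].
Proof.
move=> hK i0I w0 wG wI wnI wJ wnJ.
have [F [c [KF c0 cF cl cr]]] := complex_cover hK w0 wG.
pose T := [set x | c x != 0].
have cT x : x \notin T -> c x = 0 by rewrite inE negbK => /eqP.
have TF : T \subset F.
  by apply/subsetP => x; rewrite inE; apply: contraNT => /cF ->.
have KT := complex_face hK KF TF.
have TIJ : T \subset inside l r I J.
  apply/subsetP => x; rewrite !inE => cx; have {}cx : 0 < c x by rewrite lt_def cx c0.
  have nz (V : finType) (f : X -> V) : flux f c (f x) != 0.
    by rewrite gt_eqF // (lt_le_trans cx) // le_flux.
  apply/andP; split; apply/negPn/negP.
    by move/wnI/eqP; rewrite -cl; apply/negP; apply: nz.
  by move/wnJ/eqP; rewrite -cr; apply/negP; apply: nz.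
have [I' [J' [T' [tT' T'T i0I' clo]]]] := max_subtree l r T i0.
have T'IJ := subset_trans T'T TIJ.
have I'I : I' \subset I.
  apply/subsetP => i iI'; have [->//|ne] := eqVneq i i0.
  have /deg_gt0P[x xT' <-] := tree_degl_gt0 tT' i0I' iI' ne.
  by have := subsetP T'IJ x xT'; rewrite inE => /andP[].
have J'J : J' \subset J.
  apply/subsetP => j jJ'; have /deg_gt0P[x xT' <-] := tree_degr_gt0 tT' i0I' jJ'.
  by have := subsetP T'IJ x xT'; rewrite inE => /andP[].
have m0 : 0 < #|I|%:R :> R by rewrite ltr0n; apply/card_gt0P; exists i0.
(* Otherwise [|I'| / |I|] would be an integer strictly between 0 and 1. *)
have II' : I' = I.
  apply/eqP; rewrite eqEcard I'I -(ler_nat R).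
  have : #|I'|%:R / #|I|%:R \is a @Num.int R.
    have -> : #|I'|%:R / #|I|%:R = \sum_(j in J') flux r w j
        - \sum_(i in I') (flux l w i - #|I|%:R^-1).
      rewrite sumrB sumr_const -mulr_natl.
      under eq_bigr do rewrite -cr; under [X in _ = _ - (X - _)]eq_bigr do rewrite -cl.
      by rewrite (flux_cut cT clo); ring.
    apply: rpredB; apply: rpred_sum => u uI; first by case: (wJ u (subsetP J'J u uI)).
    exact: wI (subsetP I'I u uI).
  have I'0 : 0 < #|I'|%:R :> R by rewrite ltr0n; apply/card_gt0P; exists i0.
  rewrite leNgt => q; apply/negP => lt; have := int_lt1 q.
  rewrite ltr_pdivrMr // mul1r => /(_ lt); apply/negP; rewrite -ltNge.
  by rewrite divr_gt0.
have JJ' : J' = J.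
  apply/eqP; rewrite eqEsubset J'J; apply/subsetP => j jJ.
  have [_] := wJ j jJ; rewrite -cr => fj.
  have [x rx xT] : exists2 x, r x = j & x \in T.
    apply: contrapT => nx; move: fj; rewrite /flux big1 ?ltxx // => x /eqP rx.
    by apply: cT; apply/negP => xT; apply: nx; exists x.
  have := subsetP TIJ x xT; rewrite -rx -clo // II' inE => /andP[] //.
rewrite II' JJ' in tT'.
exists T, c; split=> //.
by rewrite (leafy_tree_eq tT' T'T (complex_leafy hK KT) TIJ).
Qed.

(** The degrees of the sets rooted at the left vertices of a tree with left
    degrees [d].  A family with these degrees contained in [G] is also what the
    lattice point [d - 1] needs in order to lie in the trimmed polytope of [G]. *)
Definition root_family I J (d : A -> nat) (E : A -> {set X}) : Prop :=
  (forall i, i \notin I -> d i = 0%N) /\ forall k, k \in I ->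
  (forall i, (deg l (E k) i + (i \in I) = d i + (k == i))%N) /\
  (forall j, deg r (E k) j = (j \in J)).

Lemma tree_root_family I J T : tree l r I J T -> exists E : A -> {set X},
  [/\ root_family I J (deg l T) E, forall k, k \in I -> E k \subset T &
      forall x, x \in T -> x \in E (l x)].
Proof.
move=> tT; have [E ER] := tree_roots tT; exists (fun k => E (inl k)); split.
- split=> [i iI | k kI]; last by have /rootedl[] := ER (inl k) kI.
  apply/eqP; rewrite -leqn0 leqNgt; apply: contraNN iI => /deg_gt0P[x xT <-].
  by rewrite (tree_mem tT xT).
- by move=> k kI; have [] := ER (inl k) kI.
- move=> x xT; apply: (rooted_full tT xT).
  by apply: ER; rewrite /= (tree_mem tT xT).
Qed.

(** For a root family this is a point in the general position required by
    [carrier_tree]. *)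
Definition average I (E : A -> {set X}) : X -> R :=
  fun x => #|I|%:R^-1 * \sum_(k in I) edge_ind R (E k) x.

Section Average.
Variables (I : {set A}) (J : {set B}) (d : A -> nat) (E : A -> {set X}).
Hypotheses (I0 : (0 < #|I|)%N) (dE : root_family I J d E).

Let I0R : #|I|%:R != 0 :> R. Proof. by rewrite pnatr_eq0 -lt0n. Qed.

Lemma average_ge0 x : 0 <= average I E x.
Proof. by rewrite mulr_ge0 ?invr_ge0 ?ler0n ?sumr_ge0 // => k _; apply: ler0n. Qed.

Lemma average_gt0 x k : k \in I -> x \in E k -> 0 < average I E x.
Proof.
move=> kI xE; rewrite mulr_gt0 ?invr_gt0 ?ltr0n // (bigD1 k) //=.
by rewrite ltr_wpDr ?sumr_ge0 // /edge_ind ?xE ?ltr0n.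
Qed.

Lemma average_sub (S : {set X}) x :
  (forall k, k \in I -> E k \subset S) -> x \notin S ->
  average I E x = 0.
Proof.
move=> ES xS; rewrite /average big1 ?mulr0 // => k kI.
by rewrite /edge_ind (negPf (contraNN (subsetP (ES k kI) x) xS)).
Qed.

Lemma flux_average (V : finType) (f : X -> V) v :
  flux f (average I E) v = #|I|%:R^-1 * \sum_(k in I) (deg f (E k) v)%:R.
Proof.
rewrite fluxZ flux_sum; congr (_ * _); apply: eq_bigr => k _; exact: flux_ind.
Qed.

Lemma flux_averagel i : i \in I ->
  flux l (average I E) i = (d i)%:R - 1 + #|I|%:R^-1.
Proof.
move=> iI; rewrite flux_average (eq_bigr (fun k => (d i)%:R - 1 + (k == i)%:R)).
  have -> : \sum_(k in I) ((d i)%:R - 1 + (k == i)%:R) =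
      #|I|%:R * ((d i)%:R - 1) + 1 :> R.
    rewrite big_split /= sumr_const mulr_natl; congr (_ + _).
    by rewrite (bigD1 i) //= eqxx big1 ?addr0 // => k /andP[_ /negPf ->].
  by field.
move=> k kI; have := (dE.2 k kI).1 i; rewrite iI => e.
have : (deg l (E k) i)%:R + 1 = (d i)%:R + (k == i)%:R :> R by rewrite -natrD -[1]/(1%:R) -natrD;
    congr (_%:R).
by move/(canRL (addrK _)) ->; ring.
Qed.

Lemma flux_averagel0 i : i \notin I -> flux l (average I E) i = 0.
Proof.
move=> iI; rewrite flux_average big1 ?mulr0 // => k kI.
have := (dE.2 k kI).1 i; rewrite (dE.1 i iI) (negPf iI) addn0 => ->.
by have /negPf-> : k != i by apply: contraNneq iI => <-.
Qed.

Lemma flux_averager j : flux r (average I E) j = (j \in J)%:R.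
Proof.
rewrite flux_average (eq_bigr (fun=> (j \in J)%:R)); last first.
  by move=> k kI; rewrite (dE.2 k kI).2.
by rewrite sumr_const -[X in _ * X]mulr_natl mulrA mulVf ?mul1r.
Qed.

End Average.

(** The average of the family lies in the cone of some tree [T] of the complex,
    with coordinates [c].  Comparing [c] with the average of the root family of
    [T] itself, the difference [z] has integral fluxes, hence integral values; it is
    less than 1, since [c <= 1] while the second average is positive on [T], and
    it sums to 0.  So [z = 0], and the left degrees agree. *)
Lemma tree_of_root_family G K I J (d : A -> nat) (E : A -> {set X}) i0 :
  forest_complex R l r G K -> i0 \in I -> root_family I J d E ->
  (forall k, k \in I -> E k \subset G) ->
  exists T, [/\ K T, tree l r I J T & deg l T =1 d].
Proof.
move=> hK i0I dE EG; have I0 : (0 < #|I|)%N by apply/card_gt0P; exists i0.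
have [|x /(average_sub EG) //|i iI|i iI|j jJ|j jJ|T [c [KT tT [c0 cT] cl cr]]] :=
    carrier_tree (J := J) (w := average I E) hK i0I.
- exact: average_ge0.
- by rewrite (flux_averagel I0 dE) // addrK rpredB ?rpred1 ?natr_int.
- exact: (flux_averagel0 dE).
- by rewrite (flux_averager I0 dE) jJ ltr01 rpred1.
- by rewrite (flux_averager I0 dE) (negPf jJ).
exists T; split=> //.
have [E' [dE' ET' TE']] := tree_root_family tT.
pose z x := c x - average I E' x.
have zl i : i \in I -> flux l z i = (d i)%:R - (deg l T i)%:R.
  by move=> iI; rewrite fluxB cl (flux_averagel I0 dE) // (flux_averagel I0 dE') //; ring.
have zl0 i : i \notin I -> flux l z i = 0.
  by move=> iI; rewrite fluxB cl (flux_averagel0 dE) // (flux_averagel0 dE') // subrr.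
have zr j : flux r z j = 0.
  by rewrite fluxB cr (flux_averager I0 dE) (flux_averager I0 dE') subrr.
have zint x : z x \is a Num.int.
  move: x; apply: (@leafy_flux _ _ _ l r R (fun a => a \is a Num.int) T z).
  - by rewrite rpred0.
  - by move=> a b; apply: rpredB.
  - by have [lT _ _] := tT; exact: lT.
  - by move=> x xT; rewrite /z cT // (average_sub ET') // subrr.
  - move=> i; case: (boolP (i \in I)) => iI; last by rewrite zl0.
    by rewrite zl // rpredB ?natr_int.
  - by move=> j; rewrite zr.
have z0 x : z x <= 0.
  case: (boolP (x \in T)) => xT; last by rewrite /z cT // (average_sub ET') // subrr.
  apply: int_lt1 => //; rewrite /z ltrBlDr.
  have a0 := average_gt0 I0 (tree_mem tT xT).1 (TE' x xT).
  have := le_flux r x c0; rewrite cr (flux_averager I0 dE).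
  by rewrite (tree_mem tT xT) => c1; apply: le_lt_trans c1 _; rewrite ltrDl.
have zE x : z x = 0.
  apply/eqP; rewrite -oppr_eq0.
  have : \sum_x - z x = 0.
    by rewrite sumrN -(sum_flux r) big1 ?oppr0.
  move/eqP; rewrite psumr_eq0 => [/allP/(_ x)|y _]; last by rewrite oppr_ge0.
  by rewrite mem_index_enum => /(_ isT).
move=> i; case: (boolP (i \in I)) => iI; last by rewrite (dE.1 i iI) (dE'.1 i iI).
have := zl i iI; rewrite /flux big1 => [|x _]; last exact: zE.
by move/esym/eqP; rewrite subr_eq0 eqr_nat => /eqP.
Qed.
End Complexes.

(** * Trees of a complex are determined by their degrees *)

Section Rigidity.
Context {R : realType} {X A B : finType} {l : X -> A} {r : X -> B}.
Implicit Types (E F G T U : {set X}) (I : {set A}) (J : {set B}).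
Implicit Types (K : {set X} -> Prop).

(** Every simplex is a face of the simplex of a tree: move the point [N * sum F]
    into general position by adding the average [rho] of a root family.  In the
    basis of the tree [T] that carries the new point the coordinates are
    [N * gam + coord rho], where [gam], the coordinates of [sum F], are integers
    and [coord rho] is at most the total weight [|J|] of [rho], whatever [T] is.
    As [N] exceeds [|J|], nonnegativity forces [gam >= 0], so [sum F] already lies
    in the cone of [T]. *)
Lemma tree_supset G K I J i0 F T0 : forest_complex R l r G K ->
  K F -> F \subset inside l r I J -> tree l r I J T0 -> T0 \subset G ->
  i0 \in I -> exists T, [/\ K T, tree l r I J T & F \subset T].
Proof.
move=> hK KF FIJ tT0 T0G i0I.
have I0 : (0 < #|I|)%N by apply/card_gt0P; exists i0.
have [E [dE ET0 _]] := tree_root_family tT0.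
pose rho : X -> R := average I E.
pose N : R := #|J|.+1%:R.
have FIJl i : i \notin I -> deg l F i = 0%N.
  move=> iI; apply/eqP; rewrite -leqn0 leqNgt; apply: contraNN iI.
  by case/deg_gt0P => x /(subsetP FIJ); rewrite inE => /andP[lx _] <-.
have FIJr j : j \notin J -> deg r F j = 0%N.
  move=> iI; apply/eqP; rewrite -leqn0 leqNgt; apply: contraNN iI.
  by case/deg_gt0P => x /(subsetP FIJ); rewrite inE => /andP[_ lx] <-.
pose w x := N * edge_ind R F x + rho x.
have fw (V : finType) (f : X -> V) v :
    flux f w v = N * (deg f F v)%:R + flux f rho v.
  by rewrite fluxD fluxZ flux_ind.
have Nint : N \is a Num.int by exact: natr_int.
have FG := complex_sub hK KF.
have [|x xG|i iI|i iI|j jJ|j jJ|T [c [KT tT [c0 cT] cl cr]]] :=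
    carrier_tree (J := J) (w := w) hK i0I.
- by move=> x; rewrite /w addr_ge0 ?average_ge0 // mulr_ge0 ?ler0n.
- rewrite /w /edge_ind (negPf (contraNN (subsetP FG x) xG)) mulr0 add0r.
  apply: (average_sub ET0); exact: contraNN (subsetP T0G x) xG.
- rewrite fw (flux_averagel I0 dE) // addrA addrK.
  by rewrite rpredD ?rpredB ?rpredM ?rpred1 ?natr_int.
- by rewrite fw (flux_averagel0 dE) // FIJl // mulr0 addr0.
- rewrite fw (flux_averager I0 dE) jJ; split; first by rewrite rpredD ?rpredM ?natr_int.
  by rewrite ltr_wpDl ?mulr_ge0 ?ler0n // ltr01.
- by rewrite fw (flux_averager I0 dE) FIJr // (negPf jJ) mulr0 addr0.
exists T; split=> //.
have /choice[g gP] : forall x, exists g : X -> R, x \in inside l r I J ->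
    [/\ forall y, g y \is a Num.int, forall y, g y <= 1,
        forall y, y \notin T -> g y = 0,
        forall i, flux l g i = (l x == i)%:R &
        forall j, flux r g j = (r x == j)%:R].
  move=> x; case: (boolP (x \in inside l r I J)) => [xI|_].
    by have [g gP] := tree_coord (R := R) tT xI; exists g.
  by exists (fun=> 0).
pose coord (u : X -> R) y := \sum_(x in inside l r I J) u x * g x y.
have coordT u y : y \notin T -> coord u y = 0.
  by move=> yT; rewrite /coord big1 // => x /gP[_ _ -> //]; rewrite mulr0.
have flux_coord u : (forall x, x \notin inside l r I J -> u x = 0) ->
    flux l (coord u) =1 flux l u /\ flux r (coord u) =1 flux r u.
  move=> uIJ; have gen (V : finType) (f : X -> V) :
      (forall x v, x \in inside l r I J -> flux f (g x) v = (f x == v)%:R) ->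
      flux f (coord u) =1 flux f u.
    move=> gf v; rewrite flux_sum [RHS]/flux big_mkcond [RHS]big_mkcond.
    apply: eq_bigr => x _; case: (boolP (x \in _)) => [xIJ | /uIJ ->].
      by rewrite fluxZ gf //; case: eqP => _; rewrite ?mulr1 ?mulr0.
    by rewrite if_same.
  by split; apply: gen => x v /gP[].
have FI x : x \notin inside l r I J -> edge_ind R F x = 0.
  by move=> xI; rewrite /edge_ind (negPf (contraNN (subsetP FIJ x) xI)).
have rI x : x \notin inside l r I J -> rho x = 0.
  move=> xI; apply: (average_sub ET0); apply: contraNN xI => /(tree_mem tT0).
  by rewrite inE => -[-> ->].
pose gam := coord (edge_ind R F).
have [gaml gamr] := flux_coord _ FI; have [rhol rhor] := flux_coord _ rI.
have lT : leafy l r T by have [lT _ _] := tT.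
have cE : c =1 (fun y => N * gam y + coord rho y).
  apply: (leafy_flux_eq lT) => // [y yT|i|j].
  - by rewrite /gam !coordT // mulr0 addr0.
  - by rewrite cl fw fluxD fluxZ gaml rhol flux_ind.
  - by rewrite cr fw fluxD fluxZ gamr rhor flux_ind.
have rho_lt y : coord rho y < N.
  apply: (@le_lt_trans _ _ #|J|%:R); last by rewrite ltr_nat.
  have -> : #|J|%:R = \sum_x rho x.
    rewrite -(sum_flux r) (eq_bigr (fun j => (j \in J)%:R)); last first.
      by move=> j _; rewrite (flux_averager I0 dE).
    rewrite -sum1_card natr_sum big_mkcond; apply: eq_bigr => j _.
    by case: (j \in J).
  rewrite /coord big_mkcond; apply: ler_sum => x _.
  have r0 : 0 <= rho x by exact: average_ge0.
  by case: ifP => // /gP[_ g1 _ _ _]; rewrite ler_piMr.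
have gamint y : gam y \is a Num.int.
  apply: rpred_sum => x /gP[gint _ _ _ _].
  by rewrite rpredM ?gint // natr_int.
have gam0 y : 0 <= gam y.
  rewrite -oppr_le0; apply: int_lt1; first by rewrite rpredN.
  have N0 : 0 < N by rewrite ltr0n.
  rewrite -(ltr_pM2l N0) mulr1; apply: le_lt_trans (rho_lt y).
  by have := c0 y; rewrite cE mulrN; lra.
apply/subsetP => x xF; apply/negPn/negP => xT.
have := complex_inj (w := gam) (w' := edge_ind R F) hK KT KF.
case/(_ _ _ _ _ _ _ x)/Wrap => [//|y|y|y yF|//|//|[]].
- exact: ler0n.
- exact: coordT.
- by rewrite /edge_ind (negPf yF).
- rewrite /gam coordT // /edge_ind xF => /eqP; by rewrite eq_sym oner_eq0.
Qed.

(** The set of [T] rooted at [k] and the set of [U] rooted at [i] have the same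
    degrees, hence they coincide. *)
Lemma shared_root G K I J T U k i E : forest_complex R l r G K ->
  K T -> K U -> tree l r I J T -> tree l r I J U -> i \in I ->
  (forall u, (deg l U u + (i == u) = deg l T u + (k == u))%N) ->
  rooted l r I J T (inl k) E -> E \subset U.
Proof.
move=> hK KT KU tT tU iI dTU /rootedl[ET El Er].
have [E' /rootedl[EU El' Er']] := tree_rooted (v := inl i) tU iI.
rewrite (complex_inj_set hK KT KU ET EU) // => [u|j]; last by rewrite Er Er'.
by have := El u; have := El' u; have := dTU u; clear; lia.
Qed.

(** The case [k = i] of [shared_root], for all [k] at once. *)
Lemma tree_degl_inj G K I J T U : forest_complex R l r G K ->
  K T -> K U -> tree l r I J T -> tree l r I J U ->
  deg l T =1 deg l U -> T = U.
Proof.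
move=> hK KT KU tT tU dTU; apply/eqP; rewrite eqEcard (eq_deg_card dTU) leqnn andbT.
apply/subsetP => x xT; have [lx _] := tree_mem tT xT.
have [E ER] := tree_rooted (v := inl (l x)) tT lx.
have ET : E \subset U by apply: (shared_root hK KT KU tT tU lx _ ER) => u; rewrite dTU.
exact: (subsetP ET x (rooted_full tT xT ER)).
Qed.

(** By [shared_root] the edge [e] stays.  If another edge [f] of [U] had the same
    right endpoint, then putting [f] in the place of [e] in the set of [T] rooted at
    [l e] would give a subset of [U] with the degrees of the set of [T] rooted at
    [l f]; but the latter contains [e]. *)
Lemma leaf_shared G K I J T U e i : forest_complex R l r G K ->
  K T -> K U -> tree l r I J T -> tree l r I J U -> i \in I ->
  (forall u, (deg l U u + (i == u) = deg l T u + (l e == u))%N) ->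
  e \in T -> deg r T (r e) = 1%N -> e \in U /\ deg r U (r e) = 1%N.
Proof.
move=> hK KT KU tT tU iI dTU eT de; have [le re] := tree_mem tT eT.
have [E ER] := tree_rooted (v := inl (l e)) tT le.
have EU := shared_root hK KT KU tT tU iI dTU ER.
have eE := rooted_full tT eT ER.
have eU := subsetP EU e eE; split=> //.
have [ET El Er] := rootedl ER.
rewrite (degD1 _ _ eU) eqxx.
have [-> //|] := posnP (deg r (U :\ e) (r e)); case/deg_gt0P => f.
rewrite !inE => /andP[fe fU] rf; exfalso.
have [lf _] := tree_mem tU fU.
have [E' /rootedl[ET' El' Er']] := tree_rooted (v := inl (l f)) tT lf.
have eE' : e \in E'.
  have /deg_gt0P[y yE' ry] : (0 < deg r E' (r e))%N by rewrite Er' re.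
  by rewrite (deg_eq1_inj de eT (subsetP ET' y yE')).
have dE1 : deg r E (r e) = 1%N by rewrite Er re.
have fE : f \notin E by apply: contraNN fe => fE; rewrite (deg_eq1_inj dE1 fE eE rf).
have fEe : f \notin E :\ e by rewrite !inE negb_and fE orbT.
have E'E : E' = f |: (E :\ e).
  apply: (complex_inj_set hK KT KU ET').
  - rewrite subUset sub1set fU (subset_trans _ EU) ?subD1set //.
  - move=> u; rewrite degU1 //; have := El u; have := El' u.
    by rewrite (degD1 l u eE); clear; lia.
  - by move=> j; rewrite degU1 // rf -(degD1 r j eE) Er Er'.
by have := eE'; rewrite E'E !inE eqxx orbF => /eqP ef; rewrite ef eqxx in fe.
Qed.

Definition degree_matched I J K K' : Prop := forall T, K T -> tree l r I J T ->
  exists T', [/\ K' T', tree l r I J T', deg l T =1 deg l T' & deg r T =1 deg r T'].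

(** If the leaf of [T'] hung on another edge [e'], then hanging it on [e] instead
    would give a root family inside [G], hence a tree [U] of [K] with
    one more edge at [l e].  The leaf of [U] still hangs on [e], that of its match
    [U'] still on [e'], and the degree at [l e] cannot grow forever. *)
Lemma leaf_matched G K K' I J e T T' :
  (forall x y, l x = l y -> r x = r y -> x = y) ->
  forest_complex R l r G K -> forest_complex R l r G K' ->
  degree_matched I J K K' ->
  K T -> K' T' -> tree l r I J T -> tree l r I J T' ->
  deg l T =1 deg l T' -> deg r T =1 deg r T' ->
  e \in T -> deg r T (r e) = 1%N -> e \in T'.
Proof.
move=> inj hK hK' H.
have [n nE] : exists n, (#|X| - deg l T (l e) < n)%N by eexists; apply: ltnSn.
elim: n T T' nE => // n IH T T' nE KT KT' tT tT' dl dr eT de.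
have [le re] := tree_mem tT eT.
have de' : deg r T' (r e) = 1%N by rewrite -dr.
have [e' [e'T' re' _]] := deg_eq1 de'.
have [<- // | ee'] := eqVneq e' e.
have lee' : l e' != l e by apply: contraNneq ee' => le'; apply/eqP/inj.
have [le' _] := tree_mem tT' e'T'.
have eT' : e \notin T'.
  by apply: contraNN ee' => eT'; rewrite (deg_eq1_inj de' e'T' eT').
have [E [[dE0 dE] ET' _]] := tree_root_family tT'.
have e'E k : k \in I -> e' \in E k.
  move=> kI; have [_ /(_ (r e))] := dE k kI; rewrite re => dk.
  have /deg_gt0P[y yE ry] : (0 < deg r (E k) (r e))%N by rewrite dk.
  by rewrite (deg_eq1_inj de' e'T' (subsetP (ET' k kI) y yE) re').
have eE k : k \in I -> e \notin E k :\ e'.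
  by move=> kI; rewrite !inE negb_and (contraNN (subsetP (ET' k kI) e) eT') orbT.
pose d u := (deg l T' u + (l e == u) - (l e' == u))%N.
have dge u : ((l e' == u) <= deg l T' u)%N.
  by case: eqP => // <-; apply: deg_gt0.
have [|k kI|U [KU tU dU]] := @tree_of_root_family R _ _ _ l r G K I J d
    (fun k => e |: (E k :\ e')) (l e) hK le.
- split=> [i iI | k kI].
    rewrite /d dE0 // (_ : (l e == i) = false) //.
    by apply/negP => /eqP lei; rewrite -lei le in iI.
  have [El Er] := dE k kI; split=> [i|j]; rewrite degU1 ?eE //.
    by have := El i; have := dge i; rewrite /d (degD1 l i (e'E k kI)); clear; lia.
  by rewrite -Er (degD1 r j (e'E k kI)) re'.
- rewrite subUset sub1set (subsetP (complex_sub hK KT)) //=.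
  apply: subset_trans (complex_sub hK' KT'); apply: subset_trans (ET' k kI).
  exact: subD1set.
have dUT u : (deg l U u + (l e' == u) = deg l T' u + (l e == u))%N.
  by rewrite dU /d; have := dge u; clear; lia.
have dUT' u : (deg l U u + (l e' == u) = deg l T u + (l e == u))%N.
  by rewrite dUT dl.
have [eU deU] := leaf_shared hK KT KU tT tU le' dUT' eT de.
have [U' [KU' tU' dlU drU]] := H U KU tU.
have eU' : e \in U'.
  apply: (IH U U') => //; move: (dUT' (l e)); rewrite (negPf lee') eqxx.
  have := deg_sub l (l e) (subsetT U); rewrite [X in (_ <= X)%N]deg_card.
  have := max_card [set x in [set: X] | l x == l e].
  by move: nE; clear; lia.
have [D DR] := tree_rooted (v := inl (l e)) tT' le.
have DU' : D \subset U'.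
  by apply: (shared_root hK' KT' KU' tT' tU' le' _ DR) => u; rewrite -dlU.
have e'D : e' \in D.
  have [DT' _ Dr] := rootedl DR.
  have /deg_gt0P[y yD ry] : (0 < deg r D (r e))%N by rewrite Dr re.
  by rewrite (deg_eq1_inj de' e'T' (subsetP DT' y yD) re').
have dU'1 : deg r U' (r e) = 1%N by rewrite -drU.
by case/eqP: ee'; apply: (deg_eq1_inj dU'1 (subsetP DU' e' e'D) eU' re').
Qed.

(** A nonnegative weight with flux 0 at [j] vanishes on the edges at [j], so
    covering is inherited. *)
Lemma complex_delete G K j : forest_complex R l r G K ->
  forest_complex R l r (G :\: [set x | r x == j])
    (fun F => K F /\ F \subset ~: [set x | r x == j]).
Proof.
set S := [set x | _] => hK; split.
- move=> F [KF FS]; rewrite setDE subsetI FS andbT; exact: complex_sub hK _ KF.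
- by move=> F [KF _]; exact: complex_leafy hK _ KF.
- move=> F F' [KF FS] F'F; split; first exact: complex_face hK _ _ KF F'F.
  exact: subset_trans FS.
- move=> F F' w w' [KF _] [KF' _]; exact: (complex_inj hK KF KF').
- move=> w w0 wG; have [|F [w' [KF w'0 w'F wl wr]]] := complex_cover hK w0.
    by move=> x xG; apply: wG; rewrite inE negb_and xG orbT.
  have w'S x : x \in S -> w' x = 0.
    rewrite inE => /eqP rx; apply/eqP; rewrite eq_le w'0 andbT.
    apply: le_trans (le_flux r x w'0) _; rewrite wr rx /flux big1 // => y /eqP ry.
    by apply: wG; rewrite !inE ry eqxx.
  exists (F :\: S), w'; split=> //.
  - split; first exact: complex_face hK _ _ KF (subsetDl _ _).
    by rewrite setDE subsetIr.
  - move=> x; rewrite inE negb_and negbK => /orP[/w'S //|]; exact: w'F.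
Qed.

End Rigidity.

Arguments degree_matched {X A B} l r I J K K'.

(** The induction statement, kept explicit because the induction step for a left
    leaf uses it with the sides exchanged. *)
Definition rigid (R : realType) (X A B : finType) (l : X -> A) (r : X -> B)
    (n : nat) : Prop :=
  forall (I : {set A}) (J : {set B}) (G : {set X}) K K' (T T' : {set X}),
  forest_complex R l r G K -> forest_complex R l r G K' ->
  degree_matched l r I J K K' -> K T -> K' T' ->
  tree l r I J T -> tree l r I J T' ->
  deg l T =1 deg l T' -> deg r T =1 deg r T' -> #|T| = n -> T = T'.

Lemma rigidC R (X A B : finType) (l : X -> A) (r : X -> B) n :
  rigid R l r n -> rigid R r l n.
Proof.
move=> H J I G K K' T T' hK hK' HM KT KT' tT tT' dr dl cT.
apply: (H I J G K K') => //; try exact: complexC; try exact: treeC.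
move=> U KU /treeC tU; have [U' [? /treeC ? ? ?]] := HM U KU tU; by exists U'.
Qed.

(** Delete the right leaf of [T] from both complexes.  The remaining complexes are
    still matched: a tree of the first one extends to a tree [V] of [K] by an edge
    at the deleted vertex, and by [leaf_matched] the match of [V] contains the same
    edge. *)
Lemma rigid_step R (X A B : finType) (l : X -> A) (r : X -> B) n I J G K K' T T' e :
  (forall x y, l x = l y -> r x = r y -> x = y) ->
  rigid R l r n ->
  forest_complex R l r G K -> forest_complex R l r G K' ->
  degree_matched l r I J K K' -> K T -> K' T' ->
  tree l r I J T -> tree l r I J T' ->
  deg l T =1 deg l T' -> deg r T =1 deg r T' -> #|T| = n.+1 ->
  e \in T -> deg r T (r e) = 1%N -> T = T'.
Proof.
move=> inj IH hK hK' H KT KT' tT tT' dl dr cT eT de.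
have [le re] := tree_mem tT eT.
have eT' := leaf_matched inj hK hK' H KT KT' tT tT' dl dr eT de.
have del (K0 : {set X} -> Prop) U x : forest_complex R l r G K0 -> K0 U ->
    x \in U -> r x = r e -> deg r U (r e) = 1%N ->
    K0 (U :\ x) /\ U :\ x \subset ~: [set y | r y == r e].
  move=> hK0 KU xU rx dU; split; first exact: complex_face hK0 _ _ KU (subD1set _ _).
  apply/subsetP => y; rewrite !inE => /andP[yx yU]; apply: contraNN yx => /eqP ry.
  by rewrite (deg_eq1_inj dU yU xU ry rx).
have de' : deg r T' (r e) = 1%N by rewrite -dr.
suff : T :\ e = T' :\ e by move=> TT'; rewrite -(setD1K eT) -(setD1K eT') TT'.
apply: (IH I (J :\ r e) _ _ _ _ _ (complex_delete (r e) hK) (complex_delete (r e) hK')).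
- move=> U [KU US] tU; have [lU UIJ cU] := tU.
  have UIJ' : U \subset inside l r I J.
    by apply/subsetP => x /(tree_mem tU); rewrite !inE => -[-> /andP[_ ->]].
  have [V [KV tV UV]] := tree_supset hK KU UIJ' tT (complex_sub hK KT) le.
  have /deg_gt0P[x xV rx] := tree_degr_gt0 tV le re.
  have xU : x \notin U.
    by apply/negP => /(subsetP US); rewrite !inE rx eqxx.
  have UE : U = V :\ x.
    apply/eqP; rewrite eqEcard; apply/andP; split.
      by apply/subsetP => y yU; rewrite !inE (subsetP UV) // andbT;
         apply: contraNneq xU => <-.
    have [_ _ cV] := tV; move: cU cV.
    by rewrite (cardsD1 x V) xV (cardsD1 (r e) J) re; lia.
  have dV : deg r V (r e) = 1%N.
    rewrite (degD1 _ _ xV) rx eqxx -UE; have [-> // |] := posnP (deg r U (r e)).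
    by case/deg_gt0P => y /(subsetP US); rewrite !inE => /eqP.
  have [V' [KV' tV' dlV drV]] := H V KV tV.
  have dVx : deg r V (r x) = 1%N by rewrite rx.
  have xV' := leaf_matched inj hK hK' H KV KV' tV tV' dlV drV xV dVx.
  have dV' : deg r V' (r e) = 1%N by rewrite -drV.
  exists (V' :\ x); split.
  - exact: del.
  - by rewrite -rx; apply: tree_cutr; rewrite ?rx.
  - by move=> u; apply/eqP; rewrite UE -(eqn_add2l (l x == u)) -!degD1 // dlV.
  - by move=> u; apply/eqP; rewrite UE -(eqn_add2l (r x == u)) -!degD1 // drV.
- exact: del.
- exact: del.
- exact: tree_cutr.
- exact: tree_cutr.
- by move=> u; apply/eqP; rewrite -(eqn_add2l (l e == u)) -!degD1 // dl.
- by move=> u; apply/eqP; rewrite -(eqn_add2l (r e == u)) -!degD1 // dr.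
- by move: cT; rewrite (cardsD1 e) eT => -[].
Qed.

Lemma trees_determined R (X A B : finType) (l : X -> A) (r : X -> B) n :
  (forall x y, l x = l y -> r x = r y -> x = y) -> rigid R l r n.
Proof.
move=> inj; elim: n => [|n IH] I J G K K' T T' hK hK' H KT KT' tT tT' dl dr cT.
  have cT' : #|T'| = 0%N by rewrite -(eq_deg_card dl).
  by rewrite (cards0_eq cT) (cards0_eq cT').
have [|e eT [de|de]] := tree_leaf tT; first by rewrite -card_gt0 cT.
- apply: (@rigid_step R X B A r l n J I G K K' T T' e) => //.
  + by move=> x y ? ?; apply: inj.
  + exact: rigidC.
  + exact: complexC.
  + exact: complexC.
  + move=> U KU /treeC tU; have [U' [? /treeC ? ? ?]] := H U KU tU; by exists U'.
  + exact: treeC.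
  + exact: treeC.
- exact: (@rigid_step R X A B l r n I J G K K' T T' e).
Qed.

(** * Forests and connected subgraphs of complete bipartite graphs *)

(** A simple path [x, y, ...] extends at [x] as long as [x] has a neighbour other
    than [y] outside the path; when that neighbour lies on the path, a cycle
    closes. *)
Lemma branching_ucycle (V : finType) (e : rel V) :
  symmetric e -> irreflexive e ->
  (forall x y, e x y -> exists2 z, z != y & e x z) ->
  forall x y, e x y -> exists2 c, ucycle e c & (2 < size c)%N.
Proof.
move=> esym eirr branch.
suff grow n x y p : (#|V| - size p < n)%N -> path e x (y :: p) ->
    uniq (x :: y :: p) -> exists2 c, ucycle e c & (2 < size c)%N.
  move=> x y exy; apply: (grow #|V|.+1 x y [::]); rewrite ?subn0 //= ?exy //.
  by rewrite inE andbT; apply: contraTneq exy => ->; rewrite eirr.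
elim: n x y p => // n IH x y p lt exyp uniqp.
have [z zy exz] : exists2 z, z != y & e x z.
  by apply: branch; case/andP: exyp.
have [zp | zp] := boolP (z \in p).
  case/splitPr: zp exyp uniqp {lt} => p1 p2 exyp uniqp.
  exists [:: z, x, y & p1] => //; apply/andP; split.
    move: exyp; rewrite /= cat_path /= rcons_path => /and4P[-> -> -> _].
    by rewrite esym exz.
  move: uniqp; rewrite -[[:: x, y & _]]/([:: x, y & p1] ++ z :: p2).
  rewrite cat_uniq => /and3P[u1 /norP[zn _] _].
  by rewrite cons_uniq u1 andbT; exact: zn.
have uz : uniq [:: z, x, y & p].
  rewrite cons_uniq uniqp andbT !inE !negb_or zy zp !andbT.
  by apply: contraTneq exz => ->; rewrite eirr.
apply: (IH z x (y :: p)) => //; last by rewrite /= esym exz.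
have : ((size p).+3 <= #|V|)%N.
  by rewrite -[(size p).+3]/(size [:: z, x, y & p]) -(card_uniqP uz) max_card.
by move: lt => /=; clear; lia.
Qed.

Section Bigraphs.
Context {m n : nat}.
Implicit Types (F G T E : {set 'I_m * 'I_n}).

Lemma sub_adjacent F G : F \subset G -> subrel (adjacent F) (adjacent G).
Proof. by move=> /subsetP FG [i|j] [i'|j'] //=; apply: FG. Qed.

Lemma adjacent_sym G : symmetric (adjacent G).
Proof. by case=> [i|j] [i'|j']. Qed.

Lemma forest_sub F G : F \subset G -> forest G -> forest F.
Proof.
move=> FG fG c /andP[cc uc]; apply: fG; rewrite /ucycle uc andbT.
exact: sub_cycle (sub_adjacent FG) _ cc.
Qed.

Lemma forest_leafy F : forest F -> leafy fst snd F.
Proof.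
move=> fF E EF /set0Pn[[i j] ijE]; apply: contrapT => noleaf.
have other (V : finType) (f : 'I_m * 'I_n -> V) x : x \in E ->
    deg f E (f x) <> 1%N -> exists y, [/\ y \in E, y != x & f y = f x].
  move=> xE; rewrite (degD1 _ _ xE) eqxx; have [-> //|] := posnP (deg f (E :\ x) (f x)).
  by case/deg_gt0P => y; rewrite !inE => /andP[yx yE] fy _; exists y.
have [||||c cyc /leq_trans] := @branching_ucycle _ (adjacent E) _ _ _ (inl i) (inr j).
- exact: adjacent_sym.
- by case.
- case=> [i1|j1] [i2|j2] //= xE.
    have [|[i3 j3] [yE yx /= Ei]] := other _ fst _ xE.
      by move=> d; apply: noleaf; left; exists i1.
    exists (inr j3); last by rewrite -Ei.
    by apply: contraNneq yx => -[<-]; rewrite -Ei.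
  have [|[i3 j3] [yE yx /= Ej]] := other _ snd _ xE.
    by move=> d; apply: noleaf; right; exists j1.
  exists (inl i3); last by rewrite -Ej.
  by apply: contraNneq yx => -[<-]; rewrite -Ej.
- exact: ijE.
have := forest_sub EF fF cyc; rewrite leqNgt => /negP c2 lt; apply: c2; exact: lt.
Qed.

Lemma connected_has_tree G (i0 : 'I_m) : connected_graph G ->
  exists2 T, tree fst snd [set: 'I_m] [set: 'I_n] T & T \subset G.
Proof.
move=> cG; have [I [J [T [tT TG i0I clo]]]] := max_subtree fst snd G i0.
have inIJ u : vertex I J u.
  have clo' : closed (adjacent G) (vertex I J).
    case=> [i|j] [i'|j'] //= xG; first exact: clo _ xG.
    exact: esym (clo _ xG).
  have : (i0 \in I) = vertex I J u := closed_connect clo' (cG (inl i0) u).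
  by rewrite i0I.
exists T => //; congr (tree fst snd _ _ T): tT.
  by apply/setP => i; rewrite inE; apply: (inIJ (inl i)).
by apply/setP => j; rewrite inE; apply: (inIJ (inr j)).
Qed.

(** The difference of the sets rooted at [i0] and at [v] has flux 1 at [i0] and is
    balanced elsewhere except at [v], so by [flux_cut] no cut separates the two. *)
Lemma tree_connected (R : realType) (i0 : 'I_m) T :
  tree fst snd [set: 'I_m] [set: 'I_n] T -> connected_graph T.
Proof.
move=> tT; have sym : connect_sym (adjacent T).
  by apply: sym_connect_sym; apply: adjacent_sym.
suff con0 v : connect (adjacent T) (inl i0) v.
  by move=> u v; apply: connect_trans (con0 v); rewrite sym.
have [E ER] := tree_roots tT.
have vT u : vertex [set: 'I_m] [set: 'I_n] u by case: u => i /=; rewrite inE.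
apply/negPn/negP => nv; set u : 'I_m + 'I_n := inl i0.
have [Eu El Er] := rootedl (ER u (vT u)); have [Ev El' Er'] := ER v (vT v).
pose w x := edge_ind R (E u) x - edge_ind R (E v) x.
have wT x : x \notin T -> w x = 0.
  move=> xT; rewrite /w /edge_ind (negPf (contraNN (subsetP Eu x) xT)).
  by rewrite (negPf (contraNN (subsetP Ev x) xT)) subrr.
pose I := [set i | connect (adjacent T) u (inl i)].
pose J := [set j | connect (adjacent T) u (inr j)].
have clo x : x \in T -> (x.1 \in I) = (x.2 \in J).
  move=> xT; rewrite !inE; apply: same_connect_r => //; apply: connect1.
  by rewrite /= -surjective_pairing.
have fwl i : i \in I -> flux fst w i = (i0 == i)%:R.
  rewrite inE => iI; rewrite fluxB !flux_ind.
  have /negPf vi : v != inl i by apply: contraNneq nv => ->.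
  have -> : deg fst (E u) i = (deg fst (E v) i + (i0 == i))%N.
    have := El' i; rewrite vi => ei.
    have aux a b c d e : (b + e = c + 0 -> a + e = c + d -> a = b + d)%N by lia.
    exact: aux ei (El i).
  by rewrite natrD addrAC subrr add0r.
have fwr j : j \in J -> flux snd w j = 0.
  rewrite inE => jJ; rewrite fluxB !flux_ind.
  have /negPf vi : v != inr j by apply: contraNneq nv => ->.
  by rewrite Er -(Er' j) vi addn0 subrr.
have i0I : i0 \in I by rewrite inE.
have := flux_cut wT clo; rewrite (eq_bigr _ fwl) [RHS](eq_bigr _ fwr) big1_eq.
rewrite (bigD1 i0) //= eqxx big1 => [|i /andP[_]]; last by rewrite eq_sym => /negPf->.
by rewrite addr0 => /eqP; rewrite oner_eq0.
Qed.

Lemma card_right_nbrs T i : #|right_nbrs T i| = deg fst T i.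
Proof.
have injp : injective (pair i : 'I_n -> _) by move=> j j' [].
rewrite deg_card -(card_imset _ injp); apply: eq_card => -[i' j]; rewrite !inE /=.
apply/imsetP/andP => [[j' jT [-> ->]] | [xT /eqP ii']].
  by move: jT; rewrite inE => ->.
by exists j; rewrite ?inE -ii'.
Qed.

Lemma card_left_nbrs T j : #|left_nbrs T j| = deg snd T j.
Proof.
have injp : injective (pair^~ j : 'I_m -> _) by move=> i i' [].
rewrite deg_card -(card_imset _ injp); apply: eq_card => -[i j']; rewrite !inE /=.
apply/imsetP/andP => [[i' jT [-> ->]] | [xT /eqP ii']].
  by move: jT; rewrite inE => ->.
by exists i; rewrite ?inE -ii'.
Qed.

Lemma LDmE T i : LDm T 0 i = (deg fst T i)%:Z - 1.
Proof. by rewrite mxE card_right_nbrs. Qed.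

Lemma RDmE T j : RDm T 0 j = (deg snd T j)%:Z - 1.
Proof. by rewrite mxE card_left_nbrs. Qed.

Lemma LDm_inj T T' : LDm T = LDm T' -> deg fst T =1 deg fst T'.
Proof.
move=> e i; have := congr1 (fun a : 'rV_m => a 0 i) e.
by rewrite !LDmE => /addIr [].
Qed.

Lemma RDm_inj T T' : RDm T = RDm T' -> deg snd T =1 deg snd T'.
Proof.
move=> e i; have := congr1 (fun a : 'rV_n => a 0 i) e.
by rewrite !RDmE => /addIr [].
Qed.

Lemma deg_transpose_fst E j : deg fst (transpose_graph E) j = deg snd E j.
Proof.
have injt : injective (fun e : 'I_m * 'I_n => (e.2, e.1)).
  by move=> [i1 j1] [i2 j2] [-> ->].
by rewrite /deg big_imset //= => x y _ _ /injt.
Qed.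

Lemma deg_transpose_snd E i : deg snd (transpose_graph E) i = deg fst E i.
Proof.
have injt : injective (fun e : 'I_m * 'I_n => (e.2, e.1)).
  by move=> [i1 j1] [i2 j2] [-> ->].
by rewrite /deg big_imset //= => x y _ _ /injt.
Qed.

End Bigraphs.

(** * Convex hulls of finite families *)

From mathcomp Require Import classical_sets interval_inference convex.

Local Open Scope classical_set_scope.
Local Open Scope ring_scope.

Section Hull.
Context {R : realType} {V : lmodType R} {X : finType}.
Local Open Scope convex_scope.
Variables (v : X -> V) (S : {set X}).

Definition convex_weights (c : X -> R) : Prop :=
  [/\ forall x, 0 <= c x, forall x, x \notin S -> c x = 0 & \sum_x c x = 1].

(** Split off one vertex and rescale the other weights to sum 1. *)
Lemma convex_comb (C : set V) (c : X -> R) : @convex_set R V C ->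
  [set v x | x in [set` S]] `<=` C -> convex_weights c -> C (\sum_x c x *: v x).
Proof.
move=> convC vC.
have [n] := ubnP #|[set x | c x != 0]%SET|; elim: n c => // n IH c lt [c0 cS c1].
have [x cx] : exists x, c x != 0.
  apply: contrapT => nx; move: c1; rewrite big1 => [/eqP|x _].
    by rewrite eq_sym oner_eq0.
  by apply: contrapT => /eqP cx; apply: nx; exists x.
have xS : x \in S by apply: contraNT cx => /cS ->.
have Cx : C (v x) by apply: vC; exists x.
rewrite (bigD1 x) //=; move: c1; rewrite (bigD1 x) //=.
set s := \sum_(i | i != x) c i => cs.
have s0 : 0 <= s by exact: sumr_ge0.
have [sz|sn] := eqVneq s 0.
  rewrite big1 => [|y yx].
    by rewrite addr0; move: cs; rewrite sz addr0 => ->; rewrite scale1r.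
  move/eqP: sz; rewrite psumr_eq0 => [/allP/(_ y)|z _]; last exact: c0.
  by rewrite mem_index_enum yx => /(_ isT)/eqP ->; rewrite scale0r.
have sp : 0 < s by rewrite lt_def sn.
pose c' y := if y == x then 0 else s^-1 * c y.
have Cc' : C (\sum_y c' y *: v y).
  apply: IH.
    apply: (@leq_trans #|[set x | c x != 0]%SET|) => //.
    apply: proper_card; apply/properP; split.
      apply/fintype.subsetP => y; rewrite !finset.inE /c'.
      have [_|_] := eqVneq y x; first by rewrite eqxx.
      by rewrite mulf_eq0 negb_or => /andP[].
    by exists x; rewrite !finset.inE // /c' eqxx eqxx.
  split=> [y|y yS|].
  - by rewrite /c'; case: eqP => // _; rewrite mulr_ge0 ?invr_ge0.
  - by rewrite /c' cS // mulr0 if_same.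
  - rewrite (bigD1 x) //= /c' eqxx add0r (eq_bigr (fun y => s^-1 * c y)).
      by rewrite -mulr_sumr mulVf.
    by move=> y /negPf ->.
have cx1 : c x <= 1 by rewrite -cs lerDl.
have -> : \sum_(y | y != x) c y *: v y = (1 - c x) *: \sum_y c' y *: v y.
  rewrite -cs [c x + s]addrC addrK scaler_sumr [RHS](bigD1 x) //= /c' eqxx.
  rewrite scale0r scaler0 add0r; apply: eq_bigr => y /negPf ->.
  by rewrite scalerA mulrA mulfV // mul1r.
have := convC (v x) (\sum_y c' y *: v y) (Itv01 (c0 x) cx1).
by rewrite !inE; apply.
Qed.

Lemma convex_hullE : convex_hull [set v x | x in [set` S]] =
  [set p | exists2 c, convex_weights c & p = \sum_x c x *: v x] :> set V.
Proof.
apply/seteqP; split; last first.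
  by move=> p [c cw ->] C [convC vC]; apply: convex_comb.
apply: smallest_sub => [|_ [x xS <-]]; last first.
  exists (fun y => (y == x)%:R); first split=> [y|y yS|].
  - exact: ler0n.
  - by case: eqP yS => // ->; rewrite (xS : is_true (x \in S)).
  - by rewrite (bigD1 x) //= eqxx big1 ?addr0 // => y /negPf ->.
  rewrite (bigD1 x) //= eqxx scale1r big1 ?addr0 // => y /negPf ->.
  by rewrite scale0r.
move=> p q t; rewrite !inE => -[c [c0 cS c1] ->] [d [d0 dS d1] ->].
have t0 : 0 <= t%:num by []. have t1 : t%:num <= 1 by [].
exists (fun y => t%:num * c y + (1 - t%:num) * d y); first split=> [y|y yS|].
- by rewrite addr_ge0 ?mulr_ge0 ?subr_ge0.
- by rewrite cS // dS // !mulr0 addr0.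
- by rewrite big_split /= -!mulr_sumr c1 d1 !mulr1 addrC subrK.
change (t%:num *: (\sum_x c x *: v x) + (1 - t%:num) *: (\sum_x d x *: v x)
  = \sum_x (t%:num * c x + (1 - t%:num) * d x) *: v x :> V).
rewrite !scaler_sumr -big_split /=; apply: eq_bigr => y _.
by rewrite [in RHS]scalerDl !scalerA.
Qed.

End Hull.

(** * Triangulations of root polytopes *)

Section RootPolytopes.
Context {R : realType} {m n : nat}.
Implicit Types (F G T E : {set 'I_m * 'I_n}) (c w : 'I_m * 'I_n -> R).

Lemma root_comb_lshift c i :
  (\sum_e c e *: root_vector R e) 0 (lshift n i) = flux fst c i.
Proof.
rewrite summxE /flux [RHS]big_mkcond; apply: eq_bigr => e _.
rewrite !mxE eqxx /= !(inj_eq (@lshift_inj _ _)) eq_lrshift subr0.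
by rewrite eq_sym; case: eqP => _; rewrite ?mulr1 ?mulr0.
Qed.

Lemma root_comb_rshift c j :
  (\sum_e c e *: root_vector R e) 0 (rshift m j) = - flux snd c j.
Proof.
rewrite summxE /flux [in RHS]big_mkcond -sumrN; apply: eq_bigr => e _.
rewrite !mxE eqxx /= !(inj_eq (@rshift_inj _ _)) eq_rlshift sub0r.
by rewrite eq_sym; case: eqP => _; rewrite ?mulrN ?mulr1 ?mulr0 ?oppr0.
Qed.

Lemma root_comb_eq c c' :
  \sum_e c e *: root_vector R e = \sum_e c' e *: root_vector R e ->
  flux fst c =1 flux fst c' /\ flux snd c =1 flux snd c'.
Proof.
move=> cc'; split=> u; first by rewrite -!root_comb_lshift cc'.
by apply: oppr_inj; rewrite -!root_comb_rshift cc'.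
Qed.

Lemma eq_root_comb c c' : flux fst c =1 flux fst c' -> flux snd c =1 flux snd c' ->
  \sum_e c e *: root_vector R e = \sum_e c' e *: root_vector R e.
Proof.
move=> cl cr; apply/rowP => k; case: (split_ordP k) => u ->.
  by rewrite !root_comb_lshift cl.
by rewrite !root_comb_rshift cr.
Qed.

Lemma root_polytopeE F : root_polytope R F =
  [set p | exists2 c, convex_weights F c & p = \sum_e c e *: root_vector R e].
Proof. exact: convex_hullE. Qed.

Lemma root_vector_comb (e : 'I_m * 'I_n) :
  root_vector R e = \sum_x (x == e)%:R *: root_vector R x.
Proof.
rewrite (bigD1 e) //= eqxx scale1r big1 ?addr0 // => x /negPf ->.
by rewrite scale0r.
Qed.

(** Each vector [root_vector e] is a vertex of the root polytope of the complete
    bipartite graph, so only [e] itself can contribute to it. *)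
Lemma root_vector_in F (e : 'I_m * 'I_n) :
  root_polytope R F (root_vector R e) -> e \in F.
Proof.
rewrite root_polytopeE => -[c [c0 cF c1]]; rewrite root_vector_comb.
move=> /root_comb_eq[cl cr]; apply: contraT => eF.
have c_eq0 x : c x = 0.
  have [-> | xe] := eqVneq x e; first exact: cF.
  apply/eqP; rewrite eq_le c0 andbT.
  have [x1 | x1] := eqVneq x.1 e.1.
    have x2 : x.2 != e.2.
      by apply: contra_neq xe => x2; rewrite [x]surjective_pairing x1 x2 -surjective_pairing.
    apply: le_trans (le_flux snd x c0) _.
    by rewrite -cr flux_one eq_sym (negPf x2).
  apply: le_trans (le_flux fst x c0) _.
  by rewrite -cl flux_one eq_sym (negPf x1).
by move: c1; rewrite big1 // => /eqP; rewrite eq_sym oner_eq0.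
Qed.

Lemma mem_root_vector F (e : 'I_m * 'I_n) :
  e \in F -> root_polytope R F (root_vector R e).
Proof. by move=> eF C [_ FC]; apply: FC; exists e. Qed.

Lemma scale_root_polytope F w s : (forall e, 0 <= w e) ->
  (forall e, e \notin F -> w e = 0) -> \sum_e w e = s -> 0 < s ->
  root_polytope R F (\sum_e (s^-1 * w e) *: root_vector R e).
Proof.
move=> w0 wF ws s0; rewrite root_polytopeE.
exists (fun e => s^-1 * w e) => //; split=> [e|e eF|].
- by rewrite mulr_ge0 // invr_ge0 ltW.
- by rewrite wF // mulr0.
- by rewrite -mulr_sumr ws mulVf // gt_eqF.
Qed.

Definition complex_of (tau : set (set 'rV[R]_(m + n)))
    (F : {set 'I_m * 'I_n}) : Prop :=
  forest F /\ tau (root_polytope R F).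

Lemma triangulation_complex G tau e0 : e0 \in G -> triangulation G tau ->
  forest_complex R fst snd G (complex_of tau).
Proof.
move=> e0G [tauF tauS tauI tauU]; split.
- move=> F [_ tF]; have [F' [F'G _ FF']] := tauF _ tF.
  apply: fintype.subset_trans F'G; apply/fintype.subsetP => e /mem_root_vector.
  by rewrite FF' => /root_vector_in.
- by move=> F [/forest_leafy].
- move=> F F' [fF tF] F'F; split; first exact: forest_sub fF.
  exact: tauS fF tF F'F.
- move=> F F' w w' [fF tF] [fF' tF'] w0 w'0 wF w'F' wl wr.
  have ss : \sum_e w' e = \sum_e w e.
    by rewrite -!(sum_flux fst); apply: eq_bigr => i _; rewrite wl.
  have : 0 <= \sum_e w e by apply: sumr_ge0 => e _; exact: w0.
  rewrite le_eqVlt.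
  case/orP => [/eqP s0 | s0].
    have zero (u : 'I_m * 'I_n -> R) : (forall e, 0 <= u e) ->
        0 = \sum_e u e -> u =1 (fun=> 0).
      move=> u0 /esym/eqP; rewrite psumr_eq0 // => /allP u1 e.
      by have := u1 e; rewrite mem_index_enum => /(_ isT)/eqP.
    by move=> e; rewrite (zero w) // (zero w') // ss.
  set s := \sum_e w e in s0 ss; have sn : s != 0 by rewrite gt_eqF.
  have p1 := scale_root_polytope w0 wF erefl s0.
  have p2 := scale_root_polytope w'0 w'F' ss s0.
  have pp : \sum_e (s^-1 * w e) *: root_vector R e =
            \sum_e (s^-1 * w' e) *: root_vector R e.
    by apply: eq_root_comb => u; rewrite !fluxZ (wl, wr).
  have : (root_polytope R F `&` root_polytope R F')
           (\sum_e (s^-1 * w e) *: root_vector R e).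
    by split=> //; rewrite pp.
  rewrite tauI // root_polytopeE => -[c [c0 cFF c1] /root_comb_eq[cl cr]].
  have cw (V : finType) (f : _ -> V) u :
      flux f w u = flux f (fun e => s * (s^-1 * w e)) u :> R.
    by apply: eq_flux => e; rewrite mulrA mulfV // mul1r.
  have scl u : flux fst (fun e => s * c e) u = flux fst w u.
    by rewrite (cw _ fst) !fluxZ -cl fluxZ.
  have scr u : flux snd (fun e => s * c e) u = flux snd w u.
    by rewrite (cw _ snd) !fluxZ -cr fluxZ.
  have scF (S : {set 'I_m * 'I_n}) :
      F :&: F' \subset S -> forall e, e \notin S -> s * c e = 0.
    move=> FS e eS; rewrite cFF ?mulr0 //.
    by apply: contraNN eS => /(fintype.subsetP FS).
  have e1 := leafy_flux_eq (forest_leafy fF) wF (scF F (finset.subsetIl _ _)).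
  have e2 := leafy_flux_eq (forest_leafy fF') w'F' (scF F' (finset.subsetIr _ _)).
  move=> e; rewrite e1 => [|u|u]; [|by rewrite scl|by rewrite scr].
  by rewrite -e2 => [//|u|u]; [rewrite -wl scl|rewrite -wr scr].
- move=> w w0 wG; have : 0 <= \sum_e w e by apply: sumr_ge0 => e _; exact: w0.
  rewrite le_eqVlt.
  have pick p : root_polytope R G p ->
      exists F, complex_of tau F /\ root_polytope R F p.
    rewrite -tauU => -[s ts sp]; have [F [_ fF sF]] := tauF s ts.
    by exists F; split; [split=> // | ]; rewrite -sF.
  case/orP => [/eqP s0 | s0].
    have [F [KF _]] := pick _ (mem_root_vector e0G).
    exists F, w; split=> // e _; move/esym/eqP: s0.
    rewrite psumr_eq0 // => /allP/(_ e).
    by rewrite mem_index_enum => /(_ isT)/eqP.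
  set s := \sum_e w e in s0; have sn : s != 0 by rewrite gt_eqF.
  have [F [KF]] := pick _ (scale_root_polytope w0 wG erefl s0).
  rewrite root_polytopeE => -[c [c0 cF c1] /root_comb_eq[cl cr]].
  exists F, (fun e => s * c e); split=> // [e|e eF|u|u].
  - by rewrite mulr_ge0 // ltW.
  - by rewrite cF ?mulr0.
  - by rewrite fluxZ -cl fluxZ mulrA mulfV // mul1r.
  - by rewrite fluxZ -cr fluxZ mulrA mulfV // mul1r.
Qed.

End RootPolytopes.

(** * Trimmed polytopes and the map phi *)

Section Trimmed.
Context {R : realType}.

Lemma simplexE m (I : {set 'I_m}) : @simplex R m I =
  [set p | exists2 c, convex_weights I c & p = \sum_i c i *: delta_mx 0 i].
Proof. exact: convex_hullE. Qed.

Lemma big_minkowski_add (V : zmodType) (J : Type) (s : seq J) (A : J -> set V)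
    (p : J -> V) : (forall j, A j (p j)) ->
  (\big[@minkowski_add V/[set 0]]_(j <- s) A j) (\sum_(j <- s) p j).
Proof.
move=> Ap; elim: s => [|j s IH]; first by rewrite !big_nil.
by rewrite !big_cons; exists (p j) => //; exists (\sum_(j <- s) p j).
Qed.

Lemma PG_flux m n (G : {set 'I_m * 'I_n}) (w : 'I_m * 'I_n -> R) :
  (forall e, 0 <= w e) -> (forall e, e \notin G -> w e = 0) ->
  (forall j, flux snd w j = 1) -> PG R G (\row_i flux fst w i).
Proof.
move=> w0 wG w1.
have -> : \row_i flux fst w i = \sum_j \sum_i w (i, j) *: delta_mx 0 i.
  apply/rowP => i; rewrite mxE summxE /flux.
  rewrite (eq_bigr (fun j => w (i, j))) => [|j _]; last first.
    rewrite summxE (bigD1 i) //= !mxE !eqxx mulr1 big1 ?addr0 // => i' ii'.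
    by rewrite !mxE eq_sym (negPf ii') andbF mulr0.
  rewrite (reindex_onto (pair i) snd) /=; last by case=> ? ? /eqP /= ->.
  by apply: eq_bigl => j; rewrite !eqxx.
apply: big_minkowski_add => j; rewrite simplexE.
exists (fun i => w (i, j)) => //; split=> // [i|].
  by rewrite finset.inE => /wG.
rewrite -(w1 j) /flux (reindex_onto (pair^~ j) fst) /=; last by case=> ? ? /eqP /= ->.
by apply: eq_bigl => i; rewrite !eqxx.
Qed.

Lemma lattice_trimmedPG m n (G : {set 'I_m * 'I_n}) (a : 'rV[int]_m)
    (E : 'I_m -> {set 'I_m * 'I_n}) :
  (forall k, E k \subset G) ->
  (forall k i, (deg fst (E k) i)%:Z = a 0 i + (k == i)%:Z) ->
  (forall k j, deg snd (E k) j = 1%N) ->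
  lattice_points (trimmedPG R G) a.
Proof.
move=> EG El Er _ [p + <-]; rewrite simplexE => -[c [c0 _ c1] ->].
pose w e := \sum_k c k * edge_ind R (E k) e.
have fw (V : finType) (f : 'I_m * 'I_n -> V) v :
    flux f w v = \sum_k c k * (deg f (E k) v)%:R.
  by rewrite flux_sum; apply: eq_bigr => k _; rewrite fluxZ flux_ind.
have -> : map_mx intr a + \sum_i c i *: delta_mx 0 i = \row_i flux fst w i :> 'rV[R]_m.
  apply/rowP => i; rewrite !mxE summxE fw.
  rewrite [RHS](eq_bigr (fun k => c k * (a 0 i)%:~R + c k * (k == i)%:R)); last first.
    move=> k _; rewrite -mulrDr; congr (_ * _).
    by rewrite -[LHS]/((deg fst (E k) i)%:Z%:~R) El intrD.
  rewrite big_split /= -mulr_suml c1 mul1r; congr (_ + _).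
  by apply: eq_bigr => k _; rewrite !mxE eqxx /= eq_sym.
apply: PG_flux => [e|e eG|j].
- by apply: sumr_ge0 => k _; rewrite mulr_ge0 ?ler0n.
- rewrite /w big1 // => k _; rewrite /edge_ind.
  by rewrite (negPf (contraNN (fintype.subsetP (EG k) e) eG)) mulr0.
- by rewrite fw -[RHS]c1; apply: eq_bigr => k _; rewrite Er mulr1.
Qed.

Context {m n : nat}.
Implicit Types (G T : {set 'I_m * 'I_n}).

Notation full_tree := (tree fst snd [set: 'I_m]%SET [set: 'I_n]%SET).

Lemma LDm_lattice G T : full_tree T -> T \subset G ->
  lattice_points (trimmedPG R G) (LDm T).
Proof.
move=> tT TG; have [E [[_ dE] ET _]] := tree_root_family tT.
apply: (@lattice_trimmedPG _ _ _ _ E) => [k|k i|k j].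
- by apply: fintype.subset_trans (ET k _) TG; rewrite finset.inE.
- have [|/(_ i) + _] := dE k; first by rewrite finset.inE.
  by rewrite finset.inE LDmE => e; rewrite addrAC -PoszD -e PoszD addrK.
- by have [|_ ->] := dE k; rewrite finset.inE.
Qed.

(** The roots are now the right vertices: [T] is read as a tree with its sides
    exchanged. *)
Lemma RDm_lattice G T : full_tree T -> T \subset G ->
  lattice_points (trimmedPG R (transpose_graph G)) (RDm T).
Proof.
move=> /treeC tT TG; have [E [[_ dE] ET _]] := tree_root_family tT.
apply: (@lattice_trimmedPG _ _ _ _ (fun k => transpose_graph (E k))) => [k|k i|k j].
- by apply: imsetS; apply: fintype.subset_trans (ET k _) TG; rewrite finset.inE.
- have [|/(_ i) + _] := dE k; first by rewrite finset.inE.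
  rewrite finset.inE RDmE deg_transpose_fst => e.
  by rewrite addrAC -PoszD -e PoszD addrK.
- by rewrite deg_transpose_snd; have [|_ ->] := dE k; rewrite finset.inE.
Qed.

(** A spanning tree with the same left degrees as [T] equals [T], so that [RDm T]
    is the only candidate value. *)
Lemma phi_tree G (tau : set (set 'rV[R]_(m + n))) T (i0 : 'I_m) :
  forest_complex R fst snd G (complex_of tau) ->
  complex_of tau T -> full_tree T -> phi G tau (LDm T) = RDm T.
Proof.
move=> hK KT tT; have TG := complex_sub hK KT.
apply: xget_unique => [|b [_ [U [[UG fU cU] tU] [/LDm_inj dU <-]]]].
  split; first exact: RDm_lattice.
  exists T => //; split; last exact: KT.2.
  by split=> //; [exact: KT.1 | exact: (tree_connected R i0 tT)].
have KU : complex_of tau U by [].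
suff -> : U = T by [].
apply: (tree_degl_inj hK KU KT _ tT) => //; split.
- exact: complex_leafy hK _ KU.
- by apply/fintype.subsetP => x _; rewrite !finset.inE.
- by rewrite (eq_deg_card dU); have [_ _] := tT.
Qed.

End Trimmed.

Lemma phi_matched (R : realType) m n (G : {set 'I_m * 'I_n}) (i0 : 'I_m)
    (tau tau' : set (set 'rV[R]_(m + n))) :
  forest_complex R fst snd G (complex_of tau) ->
  forest_complex R fst snd G (complex_of tau') ->
  (forall a, lattice_points (trimmedPG R G) a -> phi G tau a = phi G tau' a) ->
  degree_matched fst snd [set: 'I_m]%SET [set: 'I_n]%SET
    (complex_of tau) (complex_of tau').
Proof.
move=> hK hK' eq_phi T KT tT; have TG := complex_sub hK KT.
have [E [dE ET _]] := tree_root_family tT.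
have i0I : i0 \in [set: 'I_m]%SET by rewrite finset.inE.
have [|T' [KT' tT' dT']] := tree_of_root_family hK' i0I dE.
  by move=> k kI; apply: fintype.subset_trans (ET k kI) TG.
have LDmT : LDm T = LDm T' by apply/rowP => i; rewrite !LDmE dT'.
exists T'; split=> //.
apply: RDm_inj; rewrite -(phi_tree i0 hK KT tT) -(phi_tree i0 hK' KT' tT') -LDmT.
by apply: eq_phi; apply: LDm_lattice.
Qed.

Lemma phi_inj_sub (R : realType) m n (G : {set 'I_m * 'I_n}) (i0 : 'I_m)
    (tau tau' : set (set 'rV[R]_(m + n))) :
  connected_graph G -> triangulation G tau ->
  forest_complex R fst snd G (complex_of tau) ->
  forest_complex R fst snd G (complex_of tau') ->
  (forall a, lattice_points (trimmedPG R G) a -> phi G tau a = phi G tau' a) ->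
  tau `<=` tau'.
Proof.
move=> cG [tauF _ _ _] hK hK' eq_phi s ts.
have [F [FG fF sF]] := tauF s ts.
have KF : complex_of tau F by split=> //; rewrite -sF.
have [T0 tT0 T0G] := connected_has_tree i0 cG.
have i0I : i0 \in [set: 'I_m]%SET by rewrite finset.inE.
have [|T [KT tT FT]] := tree_supset hK KF _ tT0 T0G i0I.
  by apply/fintype.subsetP => x _; rewrite !finset.inE.
have HM := phi_matched i0 hK hK' eq_phi.
have [T' [KT' tT' dl dr]] := HM T KT tT.
have inj (x y : 'I_m * 'I_n) : x.1 = y.1 -> x.2 = y.2 -> x = y.
  by case: x y => ? ? [? ?] /= -> ->.
have TT' := trees_determined inj hK hK' HM KT KT' tT tT' dl dr erefl.
rewrite sF; rewrite -TT' in KT'.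
by have [_] := complex_face hK' KT' FT.
Qed.

Theorem theorem5p7 (R : realType) (m n : nat) (hm : (0 < m)%N) (hn : (0 < n)%N)
    (G : {set 'I_m * 'I_n}) (hG : connected_graph G)
    (tau tau' : set (set 'rV[R]_(m + n)))
    (htau : triangulation G tau) (htau' : triangulation G tau')
    (hdiff : tau <> tau') :
  exists2 a : 'rV[int]_m,
    lattice_points (trimmedPG R G) a & phi G tau a <> phi G tau' a.
Proof.
pose i0 := Ordinal hm; pose j0 := Ordinal hn.
have [T tT TG] := connected_has_tree i0 hG.
have [e eT _] : exists2 e, e \in T & e.2 = j0.
  by apply/deg_gt0P/(tree_degr_gt0 (i0 := i0) tT); rewrite finset.inE.
have eG := fintype.subsetP TG e eT.
have hK := triangulation_complex eG htau.
have hK' := triangulation_complex eG htau'.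
apply: contrapT => no_a; apply: hdiff.
have eq_phi a : lattice_points (trimmedPG R G) a -> phi G tau a = phi G tau' a.
  by move=> aP; apply: contrapT => ne; apply: no_a; exists a.
apply/seteqP; split; first exact: (phi_inj_sub i0 hG htau hK hK' eq_phi).
by apply: (phi_inj_sub i0 hG htau' hK' hK) => a /eq_phi.
Qed.
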